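(* Let $\psi$ be a function analytic on $D_{s,\alpha}$, with $s>0$ and $\alpha\in(\pi/2,\pi]$. Assume that there exists $c>0$ such that $\psi(z)\sim -c\,z\ln z$ as $z$ tends to $0$ in $D_{s,\alpha}$. Then for every $\beta\in(0,\alpha)$ there exist $\rho\in(0,s)$, $\rho'>0$ and a function $\Upsilon$ analytic on $D_{\rho',\beta}$ with values in $D_{\rho,\alpha}$ such that $$\forall (y,z)\in D_{\rho',\beta}\times D_{\rho,\alpha},\qquad \psi(z)=y\iff z=\Upsilon(y).$$ Moreover, as $y$ tends to $0$ in $D_{\rho',\beta}$, $$\Upsilon(y)\sim-\frac{y}{c\ln y}.$$
   Context: For $\rho>0$ and $\alpha\in(0,\pi]$, $D_{\rho,\alpha}=\{re^{i\theta}: r\in(0,\rho),\ |\theta|<\alpha\}$. $\ln$ denotes the principal determination of the logarithm (on $\mathbb C\setminus(-\infty,0]$). *)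

(* Defs.v *)
From Stdlib Require Import Reals.
From Coquelicot Require Import Coquelicot.
Open Scope R_scope.

Definition sector (rho alpha : R) (z : C) : Prop :=
  exists r theta : R, 0 < r < rho /\ Rabs theta < alpha /\
    z = ((r * cos theta)%R, (r * sin theta)%R).

(* Principal determination of the logarithm on C \ (-oo,0]:
   ln z = ln|z| + i arg z, with arg z = 2 atan (Im z / (|z| + Re z)) in (-pi,pi). *)
Definition Cln (z : C) : C :=
  (ln (Cmod z), (2 * atan (Im z / (Cmod z + Re z)))%R).

Definition analytic_on (D : C -> Prop) (f : C -> C) : Prop :=
  forall z, D z -> @ex_derive C_AbsRing C_NormedModule f z.

Definition equiv_at0 (D : C -> Prop) (f g : C -> C) : Prop :=
  forall eps : R, 0 < eps -> exists delta : R, 0 < delta /\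
    forall z, D z -> Cmod z < delta -> Cmod (f z - g z)%C <= eps * Cmod (g z).

(* Main.v *)
(* With z = exp w and y = exp v, the equation psi z = y becomes w + log (F w) = v on a
   half-strip, where F w = psi (exp w) / exp w ~ - c w takes values close to the positive
   real axis. The Cauchy estimate on discs of fixed radius gives F' / F -> 0 as
   Re w -> -oo, so w |-> v - log (F w) is a contraction of a half-strip of intermediate
   width; its fixed point W v is 2-Lipschitz in v, which makes exp (W (Cln y))
   differentiable, and log (F w) = o(w) gives the equivalent. Uniqueness holds because
   exp is injective on strips of width less than 2 pi. *)

Require Import Defs.
From Stdlib Require Import Reals Lra ClassicalEpsilon.
From Coquelicot Require Import Coquelicot.
Open Scope R_scope.

(** * Complex differentiability *)

(** The obstacle is the width of the strip. The Cauchy estimate needs discs inside [|Im w| < alpha],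
    so the contraction holds only on a narrower strip, which must be mapped into itself, while
    uniqueness is claimed on the whole strip. The half-width [b = (alpha + beta) / 2] reconciles the
    two: far to the left [log (F w)] has imaginary part at most [eta = (alpha - beta) / 2], so
    [v - log (F w)] lies in the strip of half-width [b] for every [w] of the wide strip. Hence any
    solution falls into the narrow strip and is the fixed point. Moreover [|F w| >= 1] there, so the
    image has real part at most [Re v]: a single abscissa [- A] bounds both half-strips, and
    [exp (- A)] serves as both [rho] and [rho']. The Lipschitz constant [1 / 2] is
    [|F' / F| <= 1 / 4], doubled because real and imaginary parts are estimated separately. With
    [z = exp w], [y = z F w] and [v = w + log (F w)], the equivalent of the inverse comes from the
    identity [z + y / (c v) = (z / (c v)) (F w + c v)]. *)

Definition Cderiv (f : C -> C) (z l : C) : Prop :=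
  forall eps : R, 0 < eps -> exists delta : R, 0 < delta /\
    forall h : C, Cmod h < delta ->
      Cmod (f (z + h) - f z - l * h)%C <= eps * Cmod h.

(** All estimates are made on the increment form [Cderiv]; this bridge serves to read the
    analyticity of [psi] and to state that of the inverse. *)
Lemma is_derive_Cderiv (f : C -> C) (z l : C) :
  @is_derive C_AbsRing C_NormedModule f z l <-> Cderiv f z l.
Proof.
  split.
  - intros [_ H] eps Heps.
    destruct (H z (fun P HP => HP) (mkposreal eps Heps)) as [d Hd].
    exists d; split; [apply cond_pos|].
    intros h Hh.
    specialize (Hd (z + h)%C).
    assert (E : (z + h - z)%C = h) by ring.
    simpl in Hd.
    assert (B : ball (z : AbsRing_UniformSpace C_AbsRing) d (z + h)%C).
    { change (Cmod (z + h - z)%C < d). now rewrite E. }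
    specialize (Hd B).
    change (Cmod (f (z + h) - f z - (z + h - z) * l)%C <= eps * Cmod (z + h - z)%C) in Hd.
    rewrite E in Hd.
    replace (l * h)%C with (h * l)%C by ring. exact Hd.
  - intros H. split.
    + apply is_linear_scal_l.
    + intros x Hx.
      apply (@is_filter_lim_locally_unique C_AbsRing (AbsRing_NormedModule C_AbsRing)) in Hx.
      subst x.
      intros eps. destruct (H eps (cond_pos eps)) as [d [Hd H']].
      exists (mkposreal d Hd). intros y Hy.
      change (Cmod (y - z)%C < d) in Hy.
      specialize (H' _ Hy).
      change (Cmod (f y - f z - (y - z) * l)%C <= eps * Cmod (y - z)%C).
      assert (E : (z + ((y : C) - z) = (y : C))%C) by ring. rewrite E in H'.
      rewrite (Cmult_comm (y - z) l). exact H'.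
Qed.

Lemma Cmod_sub_sym (a b : C) : Cmod (a - b)%C = Cmod (b - a)%C.
Proof.
  rewrite <- Cmod_opp. f_equal. ring.
Qed.

Lemma Cmod_triangle_rev (a b : C) : Cmod a - Cmod b <= Cmod (a - b)%C.
Proof.
  pose proof (Cmod_triangle (a - b) b)%C as H.
  replace (a - b + b)%C with a in H by ring. lra.
Qed.

Lemma im_le_Cmod (c : C) : Rabs (Im c) <= Cmod c.
Proof.
  eapply Rle_trans; [apply Rmax_r | apply (Rmax_Cmod c)].
Qed.

Lemma Cmod_le_abs (c : C) : Cmod c <= Rabs (Re c) + Rabs (Im c).
Proof.
  pose proof (Rabs_pos (Re c)); pose proof (Rabs_pos (Im c)).
  apply Rsqr_incr_0_var; [|lra].
  unfold Rsqr.
  replace (Cmod c * Cmod c) with (Cmod c ^ 2) by ring.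
  rewrite Cmod2_alt.
  rewrite <- (pow2_abs (Re c)), <- (pow2_abs (Im c)). nra.
Qed.

Lemma Cderiv_bounded (f : C -> C) (z l : C) : Cderiv f z l ->
  exists delta, 0 < delta /\ forall h, Cmod h < delta ->
    Cmod (f (z + h) - f z)%C <= (Cmod l + 1) * Cmod h.
Proof.
  intros H. destruct (H 1 Rlt_0_1) as [d [Hd H']].
  exists d; split; auto. intros h Hh. specialize (H' h Hh).
  replace (f (z + h) - f z)%C with ((f (z + h) - f z - l * h) + l * h)%C by ring.
  eapply Rle_trans; [apply Cmod_triangle|]. rewrite Cmod_mult. lra.
Qed.

Lemma Cderiv_ext (f g : C -> C) (z l : C) :
  (forall x, f x = g x) -> Cderiv f z l -> Cderiv g z l.
Proof.
  intros E H eps Heps. destruct (H eps Heps) as [d [Hd H']].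
  exists d; split; auto. intros h Hh. rewrite <- !E. auto.
Qed.

Lemma Cderiv_id (z : C) : Cderiv (fun x => x) z 1.
Proof.
  intros eps Heps. exists 1; split; [lra|]. intros h _.
  replace (z + h - z - 1 * h)%C with (RtoC 0) by ring.
  rewrite Cmod_0. apply Rmult_le_pos; [lra | apply Cmod_ge_0].
Qed.

Lemma Cderiv_affine (f : C -> C) (z l a b : C) :
  Cderiv f z l -> Cderiv (fun x => a * f x + b)%C z (a * l)%C.
Proof.
  intros H eps Heps.
  pose proof (Cmod_ge_0 a) as Ha.
  destruct (H (eps / (Cmod a + 1))) as [d [Hd H']].
  { apply Rdiv_lt_0_compat; lra. }
  exists d; split; auto. intros h Hh. specialize (H' h Hh).
  replace (a * f (z + h) + b - (a * f z + b) - a * l * h)%C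
    with (a * (f (z + h) - f z - l * h))%C by ring.
  rewrite Cmod_mult.
  pose proof (Cmod_ge_0 h).
  apply Rle_trans with ((Cmod a + 1) * (eps / (Cmod a + 1) * Cmod h)).
  - apply Rmult_le_compat; try lra. apply Cmod_ge_0.
  - right. field. lra.
Qed.

Lemma Cderiv_comp (f g : C -> C) (z l m : C) :
  Cderiv g z m -> Cderiv f (g z) l -> Cderiv (fun x => f (g x)) z (l * m)%C.
Proof.
  intros Hg Hf eps Heps.
  pose proof (Cmod_ge_0 l) as Hl. pose proof (Cmod_ge_0 m) as Hm.
  destruct (Cderiv_bounded _ _ _ Hg) as [d1 [Hd1 H1]].
  destruct (Hf (eps / (2 * (Cmod m + 1)))) as [d2 [Hd2 H2]].
  { apply Rdiv_lt_0_compat; lra. }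
  destruct (Hg (eps / (2 * (Cmod l + 1)))) as [d3 [Hd3 H3]].
  { apply Rdiv_lt_0_compat; lra. }
  exists (Rmin d1 (Rmin d3 (d2 / (Cmod m + 1)))).
  assert (0 < d2 / (Cmod m + 1)) by (apply Rdiv_lt_0_compat; lra).
  split; [repeat apply Rmin_pos; auto|].
  intros h Hh.
  assert (h1 : Cmod h < d1) by (eapply Rlt_le_trans; [apply Hh | apply Rmin_l]).
  assert (h3 : Cmod h < d3).
  { eapply Rlt_le_trans; [apply Hh|]. eapply Rle_trans; [apply Rmin_r | apply Rmin_l]. }
  assert (h2 : Cmod h < d2 / (Cmod m + 1)).
  { eapply Rlt_le_trans; [apply Hh|]. eapply Rle_trans; [apply Rmin_r | apply Rmin_r]. }
  specialize (H1 h h1). specialize (H3 h h3).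
  set (k := (g (z + h) - g z)%C) in *.
  assert (hk : Cmod k < d2).
  { apply Rle_lt_trans with (1 := H1).
    apply Rmult_lt_compat_l with (r := Cmod m + 1) in h2; [|lra].
    replace ((Cmod m + 1) * (d2 / (Cmod m + 1))) with d2 in h2 by (field; lra). lra. }
  specialize (H2 k hk).
  replace (g z + k)%C with (g (z + h)%C) in H2 by (unfold k; ring).
  replace (f (g (z + h)) - f (g z) - l * m * h)%C
    with ((f (g (z + h)) - f (g z) - l * k) + l * (k - m * h))%C by ring.
  eapply Rle_trans; [apply Cmod_triangle|]. rewrite Cmod_mult.
  pose proof (Cmod_ge_0 h) as Hh0.
  replace (eps * Cmod h) with (eps / (2 * (Cmod m + 1)) * ((Cmod m + 1) * Cmod h)
     + (Cmod l + 1) * (eps / (2 * (Cmod l + 1)) * Cmod h)) by (field; lra).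
  apply Rplus_le_compat.
  - eapply Rle_trans; [apply H2|]. apply Rmult_le_compat_l; auto.
    left; apply Rdiv_lt_0_compat; lra.
  - apply Rmult_le_compat; try lra; try apply Cmod_ge_0.
Qed.

Lemma Cderiv_mult (f g : C -> C) (z l m : C) :
  Cderiv f z l -> Cderiv g z m ->
  Cderiv (fun x => f x * g x)%C z (l * g z + f z * m)%C.
Proof.
  intros Hf Hg eps Heps.
  pose proof (Cmod_ge_0 l) as Hl. pose proof (Cmod_ge_0 m) as Hm.
  pose proof (Cmod_ge_0 (f z)) as Hfz. pose proof (Cmod_ge_0 (g z)) as Hgz.
  destruct (Cderiv_bounded _ _ _ Hf) as [d1 [Hd1 H1]].
  destruct (Cderiv_bounded _ _ _ Hg) as [d2 [Hd2 H2]].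
  destruct (Hf (eps / (3 * (Cmod (g z) + 1)))) as [d3 [Hd3 H3]].
  { apply Rdiv_lt_0_compat; lra. }
  destruct (Hg (eps / (3 * (Cmod (f z) + 1)))) as [d4 [Hd4 H4]].
  { apply Rdiv_lt_0_compat; lra. }
  set (K := (Cmod l + 1) * (Cmod m + 1)).
  assert (HK : 0 < K) by (unfold K; nra).
  assert (0 < eps / (3 * K)) by (apply Rdiv_lt_0_compat; lra).
  exists (Rmin (Rmin d1 d2) (Rmin (Rmin d3 d4) (eps / (3 * K)))).
  split; [repeat apply Rmin_pos; auto|].
  intros h Hh.
  apply Rmin_Rgt_l in Hh as [Ha Hb]. apply Rmin_Rgt_l in Ha as [h1 h2].
  apply Rmin_Rgt_l in Hb as [Hb h5]. apply Rmin_Rgt_l in Hb as [h3 h4].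
  specialize (H1 h h1). specialize (H2 h h2). specialize (H3 h h3). specialize (H4 h h4).
  (* The first product is quadratic in [h]; the radius [eps / (3 * K)] brings it below
     [eps / 3 * Cmod h]. *)
  replace (f (z + h) * g (z + h) - f z * g z - (l * g z + f z * m) * h)%C
    with ((f (z + h) - f z) * (g (z + h) - g z)
          + (g z * (f (z + h) - f z - l * h) + f z * (g (z + h) - g z - m * h)))%C by ring.
  eapply Rle_trans; [apply Cmod_triangle|].
  eapply Rle_trans; [apply Rplus_le_compat_l, Cmod_triangle|].
  rewrite !Cmod_mult.
  pose proof (Cmod_ge_0 h) as Hh0.
  replace (eps * Cmod h) with (eps / 3 * Cmod h
     + ((Cmod (g z) + 1) * (eps / (3 * (Cmod (g z) + 1)) * Cmod h)
     + (Cmod (f z) + 1) * (eps / (3 * (Cmod (f z) + 1)) * Cmod h))) by (field; lra).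
  apply Rplus_le_compat; [|apply Rplus_le_compat].
  - apply Rle_trans with (((Cmod l + 1) * Cmod h) * ((Cmod m + 1) * Cmod h)).
    + apply Rmult_le_compat; auto; apply Cmod_ge_0.
    + replace ((Cmod l + 1) * Cmod h * ((Cmod m + 1) * Cmod h))
        with (K * Cmod h * Cmod h) by (unfold K; ring).
      apply Rmult_le_compat_r; auto.
      apply Rlt_le in h5. apply Rmult_le_compat_l with (r := K) in h5; [|lra].
      replace (K * (eps / (3 * K))) with (eps / 3) in h5 by (field; lra). lra.
  - apply Rmult_le_compat; try lra; apply Cmod_ge_0.
  - apply Rmult_le_compat; try lra; apply Cmod_ge_0.
Qed.

(** * The complex exponential and logarithm *)

Definition Cexp (z : C) : C := (exp (Re z) * cos (Im z), exp (Re z) * sin (Im z)).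

Lemma Cexp_plus (a b : C) : Cexp (a + b) = (Cexp a * Cexp b)%C.
Proof.
  destruct a as [a1 a2], b as [b1 b2]. unfold Cexp, Cmult; simpl.
  rewrite exp_plus, cos_plus, sin_plus. f_equal; ring.
Qed.

Lemma Cexp_0 : Cexp 0 = 1.
Proof.
  unfold Cexp; simpl. rewrite exp_0, cos_0, sin_0.
  unfold RtoC. f_equal; ring.
Qed.

Lemma Cmod_Cexp (z : C) : Cmod (Cexp z) = exp (Re z).
Proof.
  apply Rsqr_inj; [apply Cmod_ge_0 | left; apply exp_pos|].
  unfold Rsqr. replace (Cmod (Cexp z) * Cmod (Cexp z)) with (Cmod (Cexp z) ^ 2) by ring.
  rewrite Cmod2_alt. unfold Cexp; simpl.
  pose proof (sin2_cos2 (Im z)) as H. unfold Rsqr in H. nra.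
Qed.

Lemma Cexp_neq_0 (z : C) : Cexp z <> 0.
Proof.
  apply Cmod_gt_0. rewrite Cmod_Cexp. apply exp_pos.
Qed.

Lemma Cexp_opp (z : C) : Cexp (- z) = (/ Cexp z)%C.
Proof.
  pose proof (Cexp_neq_0 z) as Hz.
  assert (H : (Cexp (- z) * Cexp z)%C = 1).
  { rewrite <- Cexp_plus, <- Cexp_0. f_equal. ring. }
  rewrite <- (Cmult_1_r (Cexp (- z))), <- (Cinv_r (Cexp z)) by auto.
  rewrite Cmult_assoc, H. ring.
Qed.

Lemma Cderiv_Cexp_0 : Cderiv Cexp 0 1.
Proof.
  intros eps Heps.
  assert (He : 0 < Rmin (eps / 8) 1) by (apply Rmin_pos; lra).
  destruct (derivable_pt_lim_exp 0 _ He) as [d1 H1].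
  destruct (derivable_pt_lim_cos 0 _ He) as [d2 H2].
  destruct (derivable_pt_lim_sin 0 _ He) as [d3 H3].
  rewrite exp_0 in H1. rewrite sin_0, cos_0 in H2. rewrite cos_0, sin_0 in H3.
  (* The real derivatives are quotient estimates that exclude [h = 0]. Here they become bounds
     without division, since one coordinate of a non-zero complex increment may vanish. *)
  assert (Hdiv : forall (u e h : R), 0 < e -> (h <> 0 -> Rabs (u / h) < e) -> (h = 0 -> u = 0) ->
    Rabs u <= e * Rabs h).
  { intros u e h e0 Hu H0. destruct (Req_dec h 0) as [E|E].
    - rewrite (H0 E), E, Rabs_R0. lra.
    - specialize (Hu E). unfold Rdiv in Hu. rewrite Rabs_mult, Rabs_inv in Hu.
      apply Rabs_pos_lt in E. left.
      apply Rmult_lt_compat_r with (r := Rabs h) in Hu; auto.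
      replace (Rabs u * / Rabs h * Rabs h) with (Rabs u) in Hu by (field; lra). lra. }
  pose proof (cond_pos d1); pose proof (cond_pos d2); pose proof (cond_pos d3).
  exists (Rmin (Rmin d1 d2) (Rmin d3 (Rmin (eps / 16) 1))).
  split; [repeat apply Rmin_pos; auto; lra|].
  intros h Hh.
  apply Rmin_Rgt_l in Hh as [Ha Hb]. apply Rmin_Rgt_l in Ha as [h1 h2].
  apply Rmin_Rgt_l in Hb as [h3 Hb]. apply Rmin_Rgt_l in Hb as [h4 h5].
  destruct h as [a b].
  pose proof (re_le_Cmod (a, b)) as Ra. pose proof (im_le_Cmod (a, b)) as Rb.
  simpl in Ra, Rb.
  set (m := Cmod (a, b)) in *.
  pose proof (Rmin_l (eps / 8) 1) as M1. pose proof (Rmin_r (eps / 8) 1) as M2.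
  set (e := Rmin (eps / 8) 1) in *.
  assert (Ea : Rabs (exp a - 1 - a) <= e * Rabs a).
  { apply Hdiv; auto.
    - intros Hn. specialize (H1 a Hn). rewrite Rplus_0_l in H1.
      replace ((exp a - 1 - a) / a) with ((exp a - 1) / a - 1) by (field; auto).
      apply H1. lra.
    - intros ->. rewrite exp_0; ring. }
  assert (Eb : Rabs (cos b - 1) <= e * Rabs b).
  { apply Hdiv; auto.
    - intros Hn. specialize (H2 b Hn). rewrite Rplus_0_l in H2.
      replace ((cos b - 1) / b) with ((cos b - 1) / b - - 0) by (field; auto).
      apply H2. lra.
    - intros ->. rewrite cos_0; ring. }
  assert (Ec : Rabs (sin b - b) <= e * Rabs b).
  { apply Hdiv; auto.
    - intros Hn. specialize (H3 b Hn). rewrite Rplus_0_l in H3.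
      replace ((sin b - b) / b) with ((sin b - 0) / b - 1) by (field; auto).
      apply H3. lra.
    - intros ->. rewrite sin_0; ring. }
  eapply Rle_trans; [apply Cmod_le_abs|].
  unfold Cexp. simpl. rewrite !Rplus_0_l, exp_0, cos_0, sin_0.
  (* Both coordinates of the remainder are split into one-variable remainders of [exp], [cos], [sin]
     with bounded factors, plus the quadratic term [a * sin b]. *)
  replace (exp a * cos b + - (1 * 1) + - (1 * a - 0 * b))
    with ((exp a - 1 - a) * cos b + ((1 + a) * (cos b - 1))) by ring.
  replace (exp a * sin b + - (1 * 0) + - (1 * b + 0 * a))
    with ((exp a - 1 - a) * sin b + (a * sin b + (sin b - b))) by ring.
  assert (Cb : Rabs (cos b) <= 1) by (apply Rabs_le, COS_bound).
  assert (Sb : Rabs (sin b) <= 1) by (apply Rabs_le, SIN_bound).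
  assert (Sb' : Rabs (sin b) <= 2 * m).
  { replace (sin b) with ((sin b - b) + b) by ring.
    eapply Rle_trans; [apply Rabs_triang|]. pose proof (Rabs_pos b). nra. }
  assert (A1 : Rabs (1 + a) <= 2).
  { eapply Rle_trans; [apply Rabs_triang|]. rewrite Rabs_R1. lra. }
  assert (T1 : Rabs ((exp a - 1 - a) * cos b) <= eps / 8 * m).
  { rewrite Rabs_mult. pose proof (Rabs_pos a). pose proof (Rabs_pos (cos b)).
    pose proof (Rabs_pos (exp a - 1 - a)). nra. }
  assert (T2 : Rabs ((1 + a) * (cos b - 1)) <= 2 * (eps / 8 * m)).
  { rewrite Rabs_mult. apply Rmult_le_compat; auto using Rabs_pos.
    pose proof (Rabs_pos b). nra. }
  assert (T3 : Rabs ((exp a - 1 - a) * sin b) <= eps / 8 * m).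
  { rewrite Rabs_mult. pose proof (Rabs_pos a). pose proof (Rabs_pos (sin b)).
    pose proof (Rabs_pos (exp a - 1 - a)). nra. }
  assert (T4 : Rabs (a * sin b) <= (eps / 16) * (2 * m)).
  { rewrite Rabs_mult. apply Rmult_le_compat; auto using Rabs_pos. lra. }
  assert (T5 : Rabs (sin b - b) <= eps / 8 * m).
  { pose proof (Rabs_pos b). nra. }
  assert (0 <= m) by apply Cmod_ge_0.
  pose proof (Rabs_triang ((exp a - 1 - a) * cos b) ((1 + a) * (cos b - 1))).
  pose proof (Rabs_triang ((exp a - 1 - a) * sin b) (a * sin b + (sin b - b))).
  pose proof (Rabs_triang (a * sin b) (sin b - b)).
  nra.
Qed.

Lemma Cderiv_Cexp (z : C) : Cderiv Cexp z (Cexp z).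
Proof.
  intros eps Heps.
  pose proof (Cmod_ge_0 (Cexp z)) as Hz.
  destruct (Cderiv_Cexp_0 (eps / (Cmod (Cexp z) + 1))) as [d [Hd H]].
  { apply Rdiv_lt_0_compat; lra. }
  exists d; split; auto. intros h Hh. specialize (H h Hh).
  rewrite Cexp_0 in H. rewrite Cplus_0_l in H. rewrite Cexp_plus.
  replace (Cexp z * Cexp h - Cexp z - Cexp z * h)%C
    with (Cexp z * (Cexp h - 1 - 1 * h))%C by ring.
  rewrite Cmod_mult. pose proof (Cmod_ge_0 h).
  apply Rle_trans with ((Cmod (Cexp z) + 1) * (eps / (Cmod (Cexp z) + 1) * Cmod h)).
  - apply Rmult_le_compat; try lra. apply Cmod_ge_0.
  - right. field. lra.
Qed.

(** Moduli give equal real parts. Then the cosine of the difference of the imaginary parts is 1, so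
    the sine of half of it vanishes, and this half-difference lies in [(-pi, pi)], where sine
    vanishes only at 0. *)
Lemma Cexp_inj (a b : C) :
  Cexp a = Cexp b -> Rabs (Im a - Im b) < 2 * PI -> a = b.
Proof.
  intros H Hi.
  assert (Hre : Re a = Re b).
  { apply exp_inv. rewrite <- !Cmod_Cexp. now rewrite H. }
  destruct a as [x p], b as [y q]. simpl in *. subst y.
  f_equal.
  unfold Cexp in H. simpl in H. injection H as H1 H2.
  pose proof (exp_pos x) as Hx.
  apply Rmult_eq_reg_l in H1; [|lra]. apply Rmult_eq_reg_l in H2; [|lra].
  assert (Hc : cos (p - q) = 1).
  { rewrite cos_minus, H1, H2. pose proof (sin2_cos2 q). unfold Rsqr in *. lra. }
  replace (p - q) with (2 * ((p - q) / 2)) in Hc by field.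
  rewrite cos_2a_sin in Hc.
  assert (Hs : sin ((p - q) / 2) = 0) by nra.
  apply Rabs_def2 in Hi.
  destruct (Rtotal_order p q) as [L | [E | L]]; auto; exfalso.
  - assert (0 < sin (- ((p - q) / 2))) by (apply sin_gt_0; lra).
    rewrite sin_neg in *. lra.
  - assert (0 < sin ((p - q) / 2)) by (apply sin_gt_0; lra). lra.
Qed.

(** The half-angle identity [sin t / (1 + cos t) = tan (t / 2)] underlies the formula for [Cln];
    [|t| < pi] makes [cos (t / 2)] positive. *)
Lemma Cln_Cexp (w : C) : Rabs (Im w) < PI -> Cln (Cexp w) = w.
Proof.
  destruct w as [x t]. simpl. intros Ht. apply Rabs_def2 in Ht.
  unfold Cln. rewrite Cmod_Cexp. simpl. rewrite ln_exp. f_equal.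
  pose proof (exp_pos x).
  assert (Hc : 0 < cos (t / 2)) by (apply cos_gt_0; lra).
  assert (E : exp x * sin t / (exp x + exp x * cos t) = tan (t / 2)).
  { assert (S : sin t = 2 * sin (t / 2) * cos (t / 2)) by (rewrite <- sin_2a; f_equal; field).
    assert (K : cos t = 2 * cos (t / 2) * cos (t / 2) - 1) by (rewrite <- cos_2a_cos; f_equal; field).
    rewrite S, K. unfold tan. field. split; [lra|].
    replace (exp x + exp x * (2 * cos (t / 2) * cos (t / 2) - 1))
      with (2 * exp x * (cos (t / 2) * cos (t / 2))) by ring.
    assert (0 < cos (t / 2) * cos (t / 2)) by nra. nra. }
  rewrite E, atan_tan by lra. field.
Qed.

(* Logarithm on the right half-plane; it coincides there with [Cln], in a form
   whose derivative along a curve is read off directly. *)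
Definition Clog (u : C) : C := (/ 2 * ln (Re u ^ 2 + Im u ^ 2), atan (Im u / Re u)).

Lemma Re_Clog (u : C) : u <> 0 -> Re (Clog u) = ln (Cmod u).
Proof.
  intros Hu. apply Cmod_gt_0 in Hu.
  change (/ 2 * ln (Re u ^ 2 + Im u ^ 2) = ln (Cmod u)).
  rewrite <- Cmod2_alt. simpl. rewrite Rmult_1_r, ln_mult by auto. field.
Qed.

Lemma Cexp_Clog (u : C) : 0 < Re u -> Cexp (Clog u) = u.
Proof.
  intros Hr.
  assert (Hm : 0 < Cmod u).
  { pose proof (re_le_Cmod u). rewrite Rabs_pos_eq in *; lra. }
  assert (Hu : u <> 0) by now apply Cmod_gt_0.
  unfold Cexp. rewrite Re_Clog, exp_ln by auto.
  destruct u as [a b]. simpl in *.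
  rewrite cos_atan, sin_atan.
  assert (E : sqrt (1 + Rsqr (b / a)) = Cmod (a, b) / a).
  { apply sqrt_lem_1.
    - pose proof (Rle_0_sqr (b / a)). lra.
    - left; apply Rdiv_lt_0_compat; auto.
    - replace (Cmod (a, b) / a * (Cmod (a, b) / a)) with (Cmod (a, b) ^ 2 / (a * a)) by (field; lra).
      rewrite Cmod2_alt. simpl. unfold Rsqr. field. lra. }
  rewrite E. f_equal; field; lra.
Qed.

(** * Goursat's lemma and the Cauchy estimate *)

(** Restriction to real lines brings real analysis to bear on [f]: it yields the continuity of the
    integrands in contour integrals and the mean value argument along segments. *)
Lemma is_derive_Re_line (f : C -> C) (a b l : C) (t : R) :
  Cderiv f (a + t * b)%C l ->
  is_derive (fun s : R => Re (f (a + s * b)%C)) t (Re (l * b)).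
Proof.
  intros H. apply is_derive_Reals. intros eps Heps.
  pose proof (Cmod_ge_0 b) as Hb.
  assert (He : 0 < eps / (2 * (Cmod b + 1))) by (apply Rdiv_lt_0_compat; lra).
  destruct (H _ He) as [d [Hd H']].
  assert (Hd' : 0 < d / (Cmod b + 1)) by (apply Rdiv_lt_0_compat; lra).
  exists (mkposreal _ Hd'). intros h Hh Hhd. simpl in Hhd.
  pose proof (Rabs_pos_lt h Hh) as Hp.
  assert (Hm : Cmod (h * b)%C = Rabs h * Cmod b) by now rewrite Cmod_mult, Cmod_R.
  assert (Hs : Cmod (h * b)%C < d).
  { rewrite Hm. apply Rmult_lt_compat_r with (r := Cmod b + 1) in Hhd; [|lra].
    replace (d / (Cmod b + 1) * (Cmod b + 1)) with d in Hhd by (field; lra). nra. }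
  specialize (H' _ Hs).
  replace (a + t * b + h * b)%C with (a + (t + h)%R * b)%C in H' by (rewrite RtoC_plus; ring).
  pose proof (Rle_trans _ _ _ (re_le_Cmod _) H') as H2. rewrite Hm in H2.
  set (p := f (a + (t + h)%R * b)%C) in *. set (q := f (a + t * b)%C) in *.
  replace (Re (p - q - l * (h * b))) with (Re p - Re q - h * Re (l * b)) in H2
    by (destruct p, q, l, b; simpl; ring).
  replace ((Re p - Re q) / h - Re (l * b)) with ((Re p - Re q - h * Re (l * b)) / h)
    by (field; auto).
  unfold Rdiv at 1. rewrite Rabs_mult, Rabs_inv.
  apply Rmult_lt_reg_r with (Rabs h); auto.
  rewrite Rmult_assoc, Rinv_l, Rmult_1_r by lra.
  apply Rle_lt_trans with (1 := H2).
  replace (eps * Rabs h) with (eps / (2 * (Cmod b + 1)) * (Rabs h * (2 * (Cmod b + 1))))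
    by (field; lra).
  apply Rmult_lt_compat_l; auto. nra.
Qed.

Lemma is_derive_Im_line (f : C -> C) (a b l : C) (t : R) :
  Cderiv f (a + t * b)%C l ->
  is_derive (fun s : R => Im (f (a + s * b)%C)) t (Im (l * b)).
Proof.
  intros H. apply (Cderiv_affine _ _ _ (- Ci) 0), is_derive_Re_line in H.
  replace (Im (l * b)) with (Re (- Ci * l * b))
    by (destruct l, b; simpl; ring).
  eapply is_derive_ext; [|exact H]. intros s.
  simpl. unfold Re, Im. ring.
Qed.

(** * Contour integrals over rectangles *)

Definition holo_rect (f : C -> C) (x y w h : R) : Prop :=
  forall a b, x <= a <= x + w -> y <= b <= y + h -> exists l, Cderiv f (a, b) l.

(* The real part of the integral of [f dz] along the boundary of
   [x, x + w] x [y, y + h]. Opposite sides are grouped so that the contribution of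
   the linear part of [f] is a constant in each integrand. *)
Definition contour (f : C -> C) (x y w h : R) : R :=
  RInt (fun t => Re (f (t, y)) - Re (f (t, y + h))) x (x + w) +
  RInt (fun t => Im (f (x, t)) - Im (f (x + w, t))) y (y + h).

Lemma continuous_Re_horizontal (f : C -> C) (t y : R) (l : C) :
  Cderiv f (t, y) l -> continuous (fun s => Re (f (s, y))) t.
Proof.
  intros H. apply (@ex_derive_continuous R_AbsRing R_NormedModule). eexists.
  assert (E : forall s : R, (s, y) = ((0, y) + s * 1)%C).
  { intros s. unfold Cplus, Cmult; simpl. f_equal; ring. }
  apply is_derive_ext with (fun s : R => Re (f ((0, y) + s * 1)%C));
    [intros s; now rewrite <- E|].
  apply is_derive_Re_line. rewrite <- E. exact H.
Qed.

Lemma continuous_Im_vertical (f : C -> C) (x t : R) (l : C) :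
  Cderiv f (x, t) l -> continuous (fun s => Im (f (x, s))) t.
Proof.
  intros H. apply (@ex_derive_continuous R_AbsRing R_NormedModule). eexists.
  assert (E : forall s : R, (x, s) = ((x, 0) + s * Ci)%C).
  { intros s. unfold Cplus, Cmult; simpl. f_equal; ring. }
  apply is_derive_ext with (fun s : R => Im (f ((x, 0) + s * Ci)%C));
    [intros s; now rewrite <- E|].
  apply is_derive_Im_line. rewrite <- E. exact H.
Qed.

Lemma ex_RInt_horizontal (f : C -> C) (x y w h a b c : R) :
  holo_rect f x y w h -> x <= a -> a <= b -> b <= x + w -> y <= c <= y + h ->
  ex_RInt (fun t => Re (f (t, c))) a b.
Proof.
  intros H ? ? ? Hc. apply (@ex_RInt_continuous R_CompleteNormedModule). intros z.
  rewrite Rmin_left, Rmax_right by lra. intros Hz.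
  destruct (H z c) as [l Hl]; try lra. eapply continuous_Re_horizontal; eauto.
Qed.

Lemma ex_RInt_vertical (f : C -> C) (x y w h a b c : R) :
  holo_rect f x y w h -> y <= a -> a <= b -> b <= y + h -> x <= c <= x + w ->
  ex_RInt (fun t => Im (f (c, t))) a b.
Proof.
  intros H ? ? ? Hc. apply (@ex_RInt_continuous R_CompleteNormedModule). intros z.
  rewrite Rmin_left, Rmax_right by lra. intros Hz.
  destruct (H c z) as [l Hl]; try lra. eapply continuous_Im_vertical; eauto.
Qed.

Lemma RInt_minus_R (f g : R -> R) (a b : R) : ex_RInt f a b -> ex_RInt g a b ->
  RInt (fun t => f t - g t) a b = RInt f a b - RInt g a b.
Proof. apply (@RInt_minus R_CompleteNormedModule). Qed.

Lemma RInt_Chasles_R (f : R -> R) (a b c : R) : ex_RInt f a b -> ex_RInt f b c ->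
  RInt f a c = RInt f a b + RInt f b c.
Proof. intros. symmetry. now apply (@RInt_Chasles R_CompleteNormedModule). Qed.

Lemma contour_sides (f : C -> C) (x y w h : R) : 0 <= w -> 0 <= h ->
  holo_rect f x y w h ->
  contour f x y w h =
    RInt (fun t => Re (f (t, y))) x (x + w) - RInt (fun t => Re (f (t, y + h))) x (x + w) +
    (RInt (fun t => Im (f (x, t))) y (y + h) - RInt (fun t => Im (f (x + w, t))) y (y + h)).
Proof.
  intros Hw Hh H. unfold contour.
  rewrite (RInt_minus_R (fun t => Re (f (t, y))) (fun t => Re (f (t, y + h)))).
  - rewrite (RInt_minus_R (fun t => Im (f (x, t))) (fun t => Im (f (x + w, t)))).
    + reflexivity.
    + apply (ex_RInt_vertical f x y w h); auto; lra.
    + apply (ex_RInt_vertical f x y w h); auto; lra.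
  - apply (ex_RInt_horizontal f x y w h); auto; lra.
  - apply (ex_RInt_horizontal f x y w h); auto; lra.
Qed.

Lemma contour_split_x (f : C -> C) (x y w1 w2 h : R) : 0 <= w1 -> 0 <= w2 -> 0 <= h ->
  holo_rect f x y (w1 + w2) h ->
  contour f x y (w1 + w2) h = contour f x y w1 h + contour f (x + w1) y w2 h.
Proof.
  intros H1 H2 Hh H.
  assert (Ha : holo_rect f x y w1 h) by (intros ? ? ? ?; apply H; lra).
  assert (Hb : holo_rect f (x + w1) y w2 h) by (intros ? ? ? ?; apply H; lra).
  rewrite !contour_sides by (auto; lra).
  rewrite <- !Rplus_assoc.
  rewrite (RInt_Chasles_R (fun t => Re (f (t, y))) x (x + w1)) by
    (apply (ex_RInt_horizontal f x y (w1 + w2) h); auto; lra).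
  rewrite (RInt_Chasles_R (fun t => Re (f (t, y + h))) x (x + w1)) by
    (apply (ex_RInt_horizontal f x y (w1 + w2) h); auto; lra).
  ring.
Qed.

Lemma contour_split_y (f : C -> C) (x y w h1 h2 : R) : 0 <= w -> 0 <= h1 -> 0 <= h2 ->
  holo_rect f x y w (h1 + h2) ->
  contour f x y w (h1 + h2) = contour f x y w h1 + contour f x (y + h1) w h2.
Proof.
  intros Hw H1 H2 H.
  assert (Ha : holo_rect f x y w h1) by (intros ? ? ? ?; apply H; lra).
  assert (Hb : holo_rect f x (y + h1) w h2) by (intros ? ? ? ?; apply H; lra).
  rewrite !contour_sides by (auto; lra).
  rewrite <- !Rplus_assoc.
  rewrite (RInt_Chasles_R (fun t => Im (f (x, t))) y (y + h1)) by
    (apply (ex_RInt_vertical f x y w (h1 + h2)); auto; lra).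
  rewrite (RInt_Chasles_R (fun t => Im (f (x + w, t))) y (y + h1)) by
    (apply (ex_RInt_vertical f x y w (h1 + h2)); auto; lra).
  ring.
Qed.

Lemma contour_quarters (f : C -> C) (x y w h : R) : 0 <= w -> 0 <= h ->
  holo_rect f x y (2 * w) (2 * h) ->
  contour f x y (2 * w) (2 * h) =
    contour f x y w h + contour f (x + w) y w h +
    (contour f x (y + h) w h + contour f (x + w) (y + h) w h).
Proof.
  intros Hw Hh H.
  replace (2 * w) with (w + w) in * by ring. replace (2 * h) with (h + h) in * by ring.
  rewrite contour_split_y, !contour_split_x; auto; try lra;
    intros ? ? ? ?; apply H; lra.
Qed.

Lemma Rabs_RInt_sub_const (g : R -> R) (a w k M : R) : 0 <= w ->
  ex_RInt g a (a + w) -> (forall t, a <= t <= a + w -> Rabs (g t - k) <= M) ->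
  Rabs (RInt g a (a + w) - k * w) <= w * M.
Proof.
  intros Hw Hg HM.
  assert (Ek : RInt (fun _ => k) a (a + w) = k * w).
  { rewrite RInt_const. change ((a + w - a) * k = k * w). ring. }
  rewrite <- Ek, <- RInt_minus_R; auto; [|apply ex_RInt_const].
  replace (w * M) with ((a + w - a) * M) by ring.
  apply abs_RInt_le_const; auto; [lra|].
  apply (@ex_RInt_minus R_CompleteNormedModule); auto. apply ex_RInt_const.
Qed.

(** The affine part of [f] contributes [Im l * h * w] on the horizontal sides and its opposite on
    the vertical ones. Only the remainder survives, at most [eps * (w + h)] at each point of the
    four sides. *)
Lemma contour_local (f : C -> C) (x y w h p q eps : R) (l : C) :
  0 <= w -> 0 <= h -> holo_rect f x y w h ->
  x <= p <= x + w -> y <= q <= y + h -> 0 <= eps ->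
  (forall a b, x <= a <= x + w -> y <= b <= y + h ->
    Cmod (f (a, b) - f (p, q) - l * ((a, b) - (p, q)))%C <= eps * Cmod ((a, b) - (p, q))%C) ->
  Rabs (contour f x y w h) <= 2 * eps * (w + h) ^ 2.
Proof.
  intros Hw Hh H Hp Hq He Hl.
  assert (Hd : forall a b, x <= a <= x + w -> y <= b <= y + h ->
    Cmod (f (a, b) - f (p, q) - l * ((a, b) - (p, q)))%C <= eps * (w + h)).
  { intros a b Ha Hb. eapply Rle_trans; [apply Hl; auto|].
    apply Rmult_le_compat_l; auto.
    eapply Rle_trans; [apply Cmod_le_abs|]. simpl.
    apply Rplus_le_compat; apply Rabs_le; lra. }
  destruct l as [l1 l2].
  assert (X : Rabs (RInt (fun t => Re (f (t, y)) - Re (f (t, y + h))) x (x + w) - (l2 * h) * w)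
    <= w * (2 * (eps * (w + h)))).
  { apply Rabs_RInt_sub_const; auto.
    - apply (@ex_RInt_minus R_CompleteNormedModule); apply (ex_RInt_horizontal f x y w h); auto; lra.
    - intros t Ht.
      assert (D1 := Rle_trans _ _ _ (re_le_Cmod _) (Hd t y Ht ltac:(lra))).
      assert (D2 := Rle_trans _ _ _ (re_le_Cmod _) (Hd t (y + h) Ht ltac:(lra))).
      simpl in D1, D2. apply Rabs_le_between in D1, D2.
      apply Rabs_le. unfold Re. lra. }
  assert (Y : Rabs (RInt (fun t => Im (f (x, t)) - Im (f (x + w, t))) y (y + h) - (- l2 * w) * h)
    <= h * (2 * (eps * (w + h)))).
  { apply Rabs_RInt_sub_const; auto.
    - apply (@ex_RInt_minus R_CompleteNormedModule); apply (ex_RInt_vertical f x y w h); auto; lra.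
    - intros t Ht.
      assert (D1 := Rle_trans _ _ _ (im_le_Cmod _) (Hd x t ltac:(lra) Ht)).
      assert (D2 := Rle_trans _ _ _ (im_le_Cmod _) (Hd (x + w) t ltac:(lra) Ht)).
      simpl in D1, D2. apply Rabs_le_between in D1, D2.
      apply Rabs_le. unfold Im. lra. }
  unfold contour. apply Rabs_le_between in X, Y. apply Rabs_le. nra.
Qed.

(** The left ends [u n] increase and the right ends [u n + w / 2 ^ n] decrease, with lengths tending
    to 0: these are adjacent sequences. *)
Lemma nested_dyadic (u : nat -> R) (w : R) :
  (forall n, u n <= u (S n) <= u n + w / 2 ^ (S n)) ->
  exists L, forall n, u n <= L <= u n + w / 2 ^ n.
Proof.
  intros H. set (v := fun n => u n + w / 2 ^ n).
  assert (Hu : forall n, u n <= u (S n)) by (intros n; apply H).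
  assert (Hv : forall n, v (S n) <= v n).
  { intros n. unfold v. specialize (H n).
    assert (E : w / 2 ^ n = 2 * (w / 2 ^ S n)).
    { simpl. field. apply pow_nonzero. lra. }
    lra. }
  assert (Hz : is_lim_seq (fun n => v n - u n) 0).
  { apply is_lim_seq_ext with (fun n => w * (/ 2) ^ n).
    - intros n. unfold v, Rdiv. rewrite pow_inv. ring.
    - evar_last; [apply is_lim_seq_mult'; [apply is_lim_seq_const|
        apply is_lim_seq_geom; rewrite Rabs_pos_eq; lra]|]. f_equal. ring. }
  destruct (ex_lim_seq_adj u v Hu Hv Hz) as [[L HL] [[L' HL'] E]].
  rewrite (is_lim_seq_unique _ _ HL), (is_lim_seq_unique _ _ HL') in E.
  injection E as <-.
  exists L. intros n. split.
  - apply (is_lim_seq_incr_compare u); auto.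
  - apply (is_lim_seq_decr_compare v); auto.
Qed.

Lemma div_pow2_small (K eps : R) : 0 < eps -> exists n, K / 2 ^ n < eps.
Proof.
  intros He.
  assert (HK : 0 < Rabs K + 1) by (pose proof (Rabs_pos K); lra).
  destruct (pow_lt_1_zero (/ 2)) with (y := eps / (Rabs K + 1)) as [n Hn].
  - rewrite Rabs_pos_eq; lra.
  - apply Rdiv_lt_0_compat; lra.
  - exists n. specialize (Hn n (le_n n)). rewrite Rabs_pos_eq in Hn by (apply pow_le; lra).
    rewrite pow_inv in Hn. apply Rmult_lt_compat_l with (r := Rabs K + 1) in Hn; [|lra].
    replace ((Rabs K + 1) * (eps / (Rabs K + 1))) with eps in Hn by (field; lra).
    apply Rle_lt_trans with (2 := Hn). unfold Rdiv. apply Rmult_le_compat_r.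
    + left. apply Rinv_0_lt_compat, pow_lt. lra.
    + pose proof (Rle_abs K). lra.
Qed.

(** Quartering, by contradiction: one can keep descending to a quarter whose contour integral
    exceeds [K] times its area. At the common point of these rectangles differentiability makes the
    integral an arbitrarily small multiple of the area, because the proportions of the rectangles
    are fixed. *)
Lemma goursat (f : C -> C) (x0 y0 w h : R) : 0 < w -> 0 < h ->
  holo_rect f x0 y0 w h -> contour f x0 y0 w h = 0.
Proof.
  intros Hw Hh Hf.
  destruct (Req_dec (contour f x0 y0 w h) 0) as [|Hne]; auto. exfalso.
  apply Rabs_pos_lt in Hne.
  (* Half the initial ratio of integral to area, so that the strict inequality in [bad] holds at the
     start. *)
  set (K := Rabs (contour f x0 y0 w h) / (2 * (w * h))).
  assert (HK : 0 < K) by (apply Rdiv_lt_0_compat; nra).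
  set (inside := fun (n : nat) x y =>
    x0 <= x /\ x + w / 2 ^ n <= x0 + w /\ y0 <= y /\ y + h / 2 ^ n <= y0 + h).
  set (bad := fun (n : nat) x y => inside n x y /\
    K * ((w / 2 ^ n) * (h / 2 ^ n)) < Rabs (contour f x y (w / 2 ^ n) (h / 2 ^ n))).
  assert (Hin : forall n x y, inside n x y -> holo_rect f x y (w / 2 ^ n) (h / 2 ^ n)).
  { intros n x y (? & ? & ? & ?) a b Ha Hb. apply Hf; lra. }
  assert (Hstep : forall n x y, bad n x y -> exists x' y',
    x <= x' <= x + w / 2 ^ S n /\ y <= y' <= y + h / 2 ^ S n /\ bad (S n) x' y').
  { intros n x y [HI HB]. pose proof (Hin _ _ _ HI) as Hq.
    assert (P : 0 < 2 ^ n) by (apply pow_lt; lra).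
    assert (Ew : w / 2 ^ n = 2 * (w / 2 ^ S n)) by (simpl; field; lra).
    assert (Eh : h / 2 ^ n = 2 * (h / 2 ^ S n)) by (simpl; field; lra).
    assert (P' : 0 < 2 ^ S n) by (apply pow_lt; lra).
    unfold inside in HI. rewrite Ew, Eh in *.
    unfold bad, inside.
    assert (0 < w / 2 ^ S n) by (apply Rdiv_lt_0_compat; lra).
    assert (0 < h / 2 ^ S n) by (apply Rdiv_lt_0_compat; lra).
    set (w' := w / 2 ^ S n) in *. set (h' := h / 2 ^ S n) in *.
    rewrite contour_quarters in HB by (auto; lra).
    destruct (Rlt_dec (K * (w' * h')) (Rabs (contour f x y w' h'))) as [|C1].
    { exists x, y. repeat split; auto; lra. }
    destruct (Rlt_dec (K * (w' * h')) (Rabs (contour f (x + w') y w' h'))) as [|C2].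
    { exists (x + w'), y. repeat split; auto; lra. }
    destruct (Rlt_dec (K * (w' * h')) (Rabs (contour f x (y + h') w' h'))) as [|C3].
    { exists x, (y + h'). repeat split; auto; lra. }
    destruct (Rlt_dec (K * (w' * h')) (Rabs (contour f (x + w') (y + h') w' h'))) as [|C4].
    { exists (x + w'), (y + h'). repeat split; auto; lra. }
    exfalso. apply Rnot_lt_le in C1, C2, C3, C4.
    set (k1 := contour f x y w' h') in *. set (k2 := contour f (x + w') y w' h') in *.
    set (k3 := contour f x (y + h') w' h') in *.
    set (k4 := contour f (x + w') (y + h') w' h') in *.
    pose proof (Rabs_triang (k1 + k2) (k3 + k4)).
    pose proof (Rabs_triang k1 k2). pose proof (Rabs_triang k3 k4). lra. }
  (* The hypothesis [bad] is placed under the existential so that choice gives a total successor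
     function; on a corner that is not bad the value is arbitrary. *)
  assert (Hchoice : forall s : nat * (R * R), exists t : R * R,
    let (n, p) := s in bad n (fst p) (snd p) ->
    fst p <= fst t <= fst p + w / 2 ^ S n /\ snd p <= snd t <= snd p + h / 2 ^ S n /\
    bad (S n) (fst t) (snd t)).
  { intros [n [x y]]. destruct (classic (bad n x y)) as [B|B].
    - destruct (Hstep n x y B) as (x' & y' & D). exists (x', y'). intros _. exact D.
    - exists (x, y). intros B'. contradiction. }
  set (next := fun s => proj1_sig (constructive_indefinite_description _ (Hchoice s))).
  assert (Hnext := fun s => proj2_sig (constructive_indefinite_description _ (Hchoice s))).
  fold next in Hnext.
  set (sq := fix sq n := match n with O => (x0, y0) | S m => next (m, sq m) end).
  assert (Hbad : forall n, bad n (fst (sq n)) (snd (sq n))).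
  { induction n as [|n IH].
    - simpl. unfold bad, inside. rewrite pow_O. unfold Rdiv. rewrite Rinv_1, !Rmult_1_r.
      repeat split; try lra.
      replace (K * (w * h)) with (Rabs (contour f x0 y0 w h) / 2) by (unfold K; field; lra).
      lra.
    - simpl. apply (Hnext (n, sq n) IH). }
  assert (Hx : exists p, forall n, fst (sq n) <= p <= fst (sq n) + w / 2 ^ n).
  { apply (nested_dyadic (fun n => fst (sq n))). intros n. apply (Hnext (n, sq n) (Hbad n)). }
  assert (Hy : exists q, forall n, snd (sq n) <= q <= snd (sq n) + h / 2 ^ n).
  { apply (nested_dyadic (fun n => snd (sq n))). intros n. apply (Hnext (n, sq n) (Hbad n)). }
  destruct Hx as [p Hp], Hy as [q Hq].
  destruct (Hf p q) as [l Hl].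
  { destruct (Hbad 0%nat) as [(? & ? & ? & ?) _]. specialize (Hp 0%nat). lra. }
  { destruct (Hbad 0%nat) as [(? & ? & ? & ?) _]. specialize (Hq 0%nat). lra. }
  (* The value for which the bound [2 * eps * (w + h) ^ 2] of [contour_local] equals [K * (w * h)];
     both scale by [4 ^ n], so this contradicts [bad] at any level. *)
  set (eps := K * (w * h) / (2 * (w + h) ^ 2)).
  assert (Heps : 0 < eps).
  { apply Rdiv_lt_0_compat; [apply Rmult_lt_0_compat; [|apply Rmult_lt_0_compat]; auto|]. assert (0 < (w + h) ^ 2) by (apply pow_lt; lra). lra. }
  destruct (Hl eps Heps) as [d [Hd Hl']].
  destruct (div_pow2_small (w + h) d Hd) as [n Hn].
  destruct (Hbad n) as [HI HB]. specialize (Hp n). specialize (Hq n).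
  assert (P : 0 < 2 ^ n) by (apply pow_lt; lra).
  assert (0 < w / 2 ^ n) by (apply Rdiv_lt_0_compat; lra).
  assert (0 < h / 2 ^ n) by (apply Rdiv_lt_0_compat; lra).
  assert (E1 : Rabs (contour f (fst (sq n)) (snd (sq n)) (w / 2 ^ n) (h / 2 ^ n))
     <= 2 * eps * (w / 2 ^ n + h / 2 ^ n) ^ 2).
  { apply contour_local with p q l; auto; try lra.
    intros a b Ha Hb.
    replace (f (a, b)) with (f ((p, q) + ((a, b) - (p, q)))%C) by (f_equal; ring).
    apply Hl'. eapply Rle_lt_trans; [apply Cmod_le_abs|].
    apply Rle_lt_trans with ((w + h) / 2 ^ n); auto.
    replace ((w + h) / 2 ^ n) with (w / 2 ^ n + h / 2 ^ n) by (field; lra). simpl.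
    apply Rplus_le_compat; apply Rabs_le; lra. }
  replace (2 * eps * (w / 2 ^ n + h / 2 ^ n) ^ 2) with (K * (w / 2 ^ n * (h / 2 ^ n))) in E1
    by (unfold eps; field; lra).
  lra.
Qed.

(** * The Cauchy estimate for the derivative *)

Lemma Cexp_2PI (x y : R) : Cexp (x, y + 2 * PI) = Cexp (x, y).
Proof.
  unfold Cexp; simpl. rewrite cos_plus, sin_plus, cos_2PI, sin_2PI.
  f_equal; ring.
Qed.

(* In the coordinate [z = z0 + exp zeta] the difference quotient of [f] at [z0] is a
   2 i pi-periodic function of [zeta], so Goursat makes its mean over vertical segments
   independent of [Re zeta]; as [Re zeta] tends to -oo this mean tends to the derivative. *)
Lemma cauchy_estimate_Im (f : C -> C) (z0 l : C) (r M : R) : 0 < r ->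
  (forall z, Cmod (z - z0)%C <= r -> exists l', Cderiv f z l') ->
  (forall z, Cmod (z - z0)%C <= r -> Cmod (f z - f z0)%C <= M) ->
  Cderiv f z0 l -> Rabs (Im l) <= M / r.
Proof.
  intros Hr Hf HM Hl.
  set (g := fun u => ((f (z0 + Cexp u) - f z0) * Cexp (- u))%C).
  apply le_epsilon. intros eps Heps.
  destruct (Hl eps Heps) as [d [Hd Hl']].
  assert (Hm : 0 < Rmin (d / 2) (r / 2)) by (apply Rmin_pos; lra).
  (* The inner radius [exp a] is below [d], where the expansion of [f] at [z0] applies, and below
     [r], so that the rectangle has positive width. *)
  set (a := ln (Rmin (d / 2) (r / 2))).
  assert (Ea : exp a = Rmin (d / 2) (r / 2)) by (apply exp_ln; auto).
  assert (Hab : a < ln r).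
  { apply ln_increasing; auto. pose proof (Rmin_r (d / 2) (r / 2)). lra. }
  assert (Hg : holo_rect g a 0 (ln r - a) (2 * PI)).
  { intros x y Hx Hy.
    destruct (Hf (z0 + Cexp (x, y))%C) as [k Hk].
    { replace (z0 + Cexp (x, y) - z0)%C with (Cexp (x, y)) by ring.
      rewrite Cmod_Cexp. simpl. rewrite <- (exp_ln r) by auto.
      destruct (Rle_lt_or_eq_dec x (ln r)) as [L | ->]; try lra.
      left. apply exp_increasing; auto. }
    eexists. unfold g. apply (Cderiv_mult (fun u => f (z0 + Cexp u) - f z0)%C).
    - apply Cderiv_ext with (fun u => 1 * f (z0 + Cexp u) + (- f z0))%C; [intros; ring|].
      apply Cderiv_affine, (Cderiv_comp f (fun u => z0 + Cexp u)%C); [|exact Hk].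
      apply Cderiv_ext with (fun u => 1 * Cexp u + z0)%C; [intros; ring|].
      apply Cderiv_affine, Cderiv_Cexp.
    - apply (Cderiv_comp Cexp (fun u => - u)%C); [|apply Cderiv_Cexp].
      apply Cderiv_ext with (fun u => (- (1)) * u + 0)%C; [intros; ring|].
      apply Cderiv_affine, Cderiv_id. }
  pose proof PI_RGT_0 as Hpi.
  assert (Hz := goursat g a 0 (ln r - a) (2 * PI) ltac:(lra) ltac:(lra) Hg).
  rewrite contour_sides in Hz by (auto; lra).
  (* By periodicity the horizontal sides cancel, leaving the equality of the two vertical
     integrals. *)
  rewrite (RInt_ext (fun t => Re (g (t, 0 + 2 * PI))) (fun t => Re (g (t, 0)))) in Hz.
  2:{ intros t _. f_equal. unfold g.
      rewrite Cexp_2PI, !Cexp_opp, Cexp_2PI. reflexivity. }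
  rewrite !Rplus_0_l in Hz.
  replace (a + (ln r - a)) with (ln r) in Hz by ring.
  (* On the inner circle the difference quotient is within [eps] of [l]. *)
  assert (Ha : Rabs (RInt (fun t => Im (g (a, t))) 0 (0 + 2 * PI) - Im l * (2 * PI))
    <= 2 * PI * eps).
  { apply Rabs_RInt_sub_const; [lra| |].
    - apply (ex_RInt_vertical g a 0 (ln r - a) (2 * PI)); auto; lra.
    - intros t _.
      replace (Im (g (a, t)) - Im l) with (Im (g (a, t) - l)%C) by reflexivity.
      eapply Rle_trans; [apply im_le_Cmod|].
      replace (g (a, t) - l)%C
        with ((f (z0 + Cexp (a, t)) - f z0 - l * Cexp (a, t)) * Cexp (- (a, t)))%C.
      2:{ unfold g. rewrite Cexp_opp. field. apply Cexp_neq_0. }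
      rewrite Cmod_mult, Cexp_opp, Cmod_inv by apply Cexp_neq_0.
      assert (Hp : 0 < Cmod (Cexp (a, t))) by apply Cmod_gt_0, Cexp_neq_0.
      apply Rmult_le_reg_r with (Cmod (Cexp (a, t))); auto.
      rewrite Rmult_assoc, Rinv_l, Rmult_1_r by lra. apply Hl'.
      rewrite Cmod_Cexp. simpl. rewrite Ea. pose proof (Rmin_l (d / 2) (r / 2)). lra. }
  (* On the circle of radius [r] the quotient has modulus at most [M / r]; the subtracted constant
     is 0. *)
  assert (Hb : Rabs (RInt (fun t => Im (g (ln r, t))) 0 (0 + 2 * PI) - 0 * (2 * PI))
    <= 2 * PI * (M / r)).
  { apply Rabs_RInt_sub_const; [lra| |].
    - apply (ex_RInt_vertical g a 0 (ln r - a) (2 * PI)); auto; lra.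
    - intros t _. rewrite Rminus_0_r.
      eapply Rle_trans; [apply im_le_Cmod|].
      unfold g. rewrite Cmod_mult, Cexp_opp, Cmod_inv by apply Cexp_neq_0.
      rewrite Cmod_Cexp. simpl. rewrite exp_ln by auto.
      apply Rmult_le_compat_r; [left; apply Rinv_0_lt_compat; auto|].
      apply HM. replace (z0 + Cexp (ln r, t) - z0)%C with (Cexp (ln r, t)) by ring.
      rewrite Cmod_Cexp. simpl. rewrite exp_ln by auto. lra. }
  rewrite !Rplus_0_l in *.
  apply Rabs_le_between in Ha, Hb. apply Rabs_le. nra.
Qed.

(** A rotation recovers the modulus from the imaginary part: for [k = i * conj l] one has
    [Im (k * l) = |l|^2] and [|k| = |l|], so the previous bound applied to [k * f] yields the claim
    after division by [|l|]. *)
Lemma cauchy_estimate (f : C -> C) (z0 l : C) (r M : R) : 0 < r ->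
  (forall z, Cmod (z - z0)%C <= r -> exists l', Cderiv f z l') ->
  (forall z, Cmod (z - z0)%C <= r -> Cmod (f z - f z0)%C <= M) ->
  Cderiv f z0 l -> Cmod l <= M / r.
Proof.
  intros Hr Hf HM Hl.
  assert (HM0 : 0 <= M).
  { eapply Rle_trans; [apply Cmod_ge_0|]. apply (HM z0).
    replace (z0 - z0)%C with (RtoC 0) by ring. rewrite Cmod_0. lra. }
  destruct (Req_dec (Cmod l) 0) as [E|E].
  { rewrite E. apply Rle_div_r; lra. }
  pose proof (Cmod_ge_0 l) as Hl0.
  set (k := (Ci * Cconj l)%C).
  assert (Hk : Cmod k = Cmod l).
  { unfold k. rewrite Cmod_mult, Cmod_Ci, Cmod_conj. ring. }
  assert (H : Rabs (Im (k * l)) <= (Cmod k * M) / r).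
  { apply (cauchy_estimate_Im (fun z => k * f z + 0)%C z0); auto.
    - intros z Hz. destruct (Hf z Hz) as [m Hm]. eexists. apply Cderiv_affine, Hm.
    - intros z Hz. replace (k * f z + 0 - (k * f z0 + 0))%C with (k * (f z - f z0))%C by ring.
      rewrite Cmod_mult. apply Rmult_le_compat_l; [apply Cmod_ge_0|]. apply HM, Hz.
    - apply Cderiv_affine, Hl. }
  replace (Im (k * l)) with (Cmod l ^ 2) in H.
  2:{ rewrite Cmod2_alt. unfold k. destruct l; simpl. ring. }
  rewrite Rabs_pos_eq, Hk in H by nra.
  apply Rmult_le_reg_l with (Cmod l); [lra|]. unfold Rdiv in *. lra.
Qed.

(** * Inverting [w + Clog (F w)] on a half-strip *)

Lemma Rabs_increment_01 (g : R -> R) (K : R) :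
  (forall t, 0 <= t <= 1 -> exists d, is_derive g t d /\ Rabs d <= K) ->
  Rabs (g 1 - g 0) <= K.
Proof.
  intros H.
  assert (D : forall t, 0 <= t <= 1 -> is_derive g t (Derive g t) /\ Rabs (Derive g t) <= K).
  { intros t Ht. destruct (H t Ht) as [d [H1 H2]].
    rewrite (is_derive_unique _ _ _ H1). auto. }
  destruct (MVT_gen g 0 1 (Derive g)) as [t [Ht E]].
  - intros t. rewrite Rmin_left, Rmax_right by lra. intros Ht. apply D. lra.
  - intros t. rewrite Rmin_left, Rmax_right by lra. intros Ht.
    apply derivable_continuous_pt. exists (Derive g t). apply is_derive_Reals, D, Ht.
  - rewrite Rmin_left, Rmax_right in Ht by lra.
    rewrite E, Rminus_0_r, Rmult_1_r. apply D, Ht.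
Qed.

(** Along the segment the logarithm of [f] has derivative [f' * (b - a) / f], of modulus at most
    [K * |b - a|]. The mean value theorem is real, so it is applied to each coordinate; adding the
    two bounds costs the factor 2. *)
Lemma Clog_lipschitz (f : C -> C) (a b : C) (K : R) : 0 <= K ->
  (forall t : R, 0 <= t <= 1 -> exists l, Cderiv f (a + t * (b - a))%C l /\
    0 < Re (f (a + t * (b - a))%C) /\ Cmod l <= K * Cmod (f (a + t * (b - a))%C)) ->
  Cmod (Clog (f b) - Clog (f a))%C <= 2 * K * Cmod (b - a)%C.
Proof.
  intros HK H.
  assert (E1 : (a + 1 * (b - a))%C = b) by ring.
  assert (E0 : (a + 0 * (b - a))%C = a) by ring.
  set (q := fun t : R => f (a + t * (b - a))%C).
  (* With [n] the real or imaginary part of [conj p * l * (b - a)], the quotient by [|p|^2] is the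
     same part of [l * (b - a) / p]. *)
  assert (Hquot : forall (n : R) (p : C), 0 < Re p -> forall l, Cmod l <= K * Cmod p ->
    Rabs n <= Cmod (Cconj p * (l * (b - a)))%C ->
    Rabs (n / (Re p ^ 2 + Im p ^ 2)) <= K * Cmod (b - a)%C).
  { intros n p Hp l Hl Hn.
    pose proof (re_le_Cmod p). rewrite Rabs_pos_eq in * by lra.
    rewrite <- Cmod2_alt. rewrite !Cmod_mult, Cmod_conj in Hn.
    unfold Rdiv. rewrite Rabs_mult, Rabs_inv, (Rabs_pos_eq (Cmod p ^ 2)) by nra.
    assert (0 < Cmod p ^ 2) by nra.
    apply Rmult_le_reg_r with (Cmod p ^ 2); auto.
    rewrite Rmult_assoc, Rinv_l, Rmult_1_r by lra.
    apply Rle_trans with (1 := Hn).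
    pose proof (Cmod_ge_0 (b - a)%C).
    apply Rle_trans with (Cmod p * ((K * Cmod p) * Cmod (b - a)%C)); [|right; ring].
    apply Rmult_le_compat_l; [lra|]. apply Rmult_le_compat_r; auto. }
  assert (HR : Rabs (Re (Clog (q 1)) - Re (Clog (q 0))) <= K * Cmod (b - a)%C).
  { apply (Rabs_increment_01 (fun t => Re (Clog (q t)))). intros t Ht.
    destruct (H t Ht) as (l & Hl & Hp & Hb). fold (q t) in Hp, Hb.
    pose proof (is_derive_Re_line _ _ _ _ _ Hl) as DR.
    pose proof (is_derive_Im_line _ _ _ _ _ Hl) as DI.
    exists ((Re (q t) * Re (l * (b - a)) + Im (q t) * Im (l * (b - a)))
       / (Re (q t) ^ 2 + Im (q t) ^ 2)). split.
    - change (is_derive (fun t => / 2 * ln (Re (q t) ^ 2 + Im (q t) ^ 2)) t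
       ((Re (q t) * Re (l * (b - a)) + Im (q t) * Im (l * (b - a)))
       / (Re (q t) ^ 2 + Im (q t) ^ 2))).
      assert (0 < Re (q t) ^ 2 + Im (q t) ^ 2) by nra.
      evar_last; [apply is_derive_scal; apply (is_derive_comp ln
         (fun t => Re (q t) ^ 2 + Im (q t) ^ 2));
         [apply is_derive_Reals, derivable_pt_lim_ln; auto|
          apply (@is_derive_plus R_AbsRing R_NormedModule);
          apply is_derive_pow; [exact DR|exact DI]]|].
      unfold scal, plus; simpl; unfold mult; simpl. fold (q t). unfold Rdiv. field.
      lra.
    - apply Hquot with l; auto.
      replace (Re (q t) * Re (l * (b - a)) + Im (q t) * Im (l * (b - a)))
        with (Re (Cconj (q t) * (l * (b - a)))) by
        (destruct (q t), (l * (b - a))%C; simpl; ring).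
      apply re_le_Cmod. }
  assert (HI : Rabs (Im (Clog (q 1)) - Im (Clog (q 0))) <= K * Cmod (b - a)%C).
  { apply (Rabs_increment_01 (fun t => Im (Clog (q t)))). intros t Ht.
    destruct (H t Ht) as (l & Hl & Hp & Hb). fold (q t) in Hp, Hb.
    pose proof (is_derive_Re_line _ _ _ _ _ Hl) as DR.
    pose proof (is_derive_Im_line _ _ _ _ _ Hl) as DI.
    exists ((Re (q t) * Im (l * (b - a)) - Im (q t) * Re (l * (b - a)))
       / (Re (q t) ^ 2 + Im (q t) ^ 2)). split.
    - change (is_derive (fun t => atan (Im (q t) / Re (q t))) t
       ((Re (q t) * Im (l * (b - a)) - Im (q t) * Re (l * (b - a)))
       / (Re (q t) ^ 2 + Im (q t) ^ 2))).
      assert (0 < Re (q t) ^ 2 + Im (q t) ^ 2) by nra.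
      evar_last; [apply (is_derive_comp atan (fun t => Im (q t) / Re (q t)));
         [apply is_derive_Reals, derivable_pt_lim_atan|
          apply is_derive_div; [exact DI|exact DR|fold (q t); lra]]|].
      unfold scal; simpl; unfold mult; simpl. fold (q t). field.
      split; [lra|]. nra.
    - apply Hquot with l; auto.
      replace (Re (q t) * Im (l * (b - a)) - Im (q t) * Re (l * (b - a)))
        with (Im (Cconj (q t) * (l * (b - a)))) by
        (destruct (q t), (l * (b - a))%C; simpl; ring).
      apply im_le_Cmod. }
  unfold q in HR, HI. rewrite E1, E0 in HR, HI.
  eapply Rle_trans; [apply Cmod_le_abs|].
  change (Rabs (Re (Clog (f b)) - Re (Clog (f a))) + Rabs (Im (Clog (f b)) - Im (Clog (f a)))
    <= 2 * K * Cmod (b - a)%C).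
  lra.
Qed.

Lemma geometric_limit (a : nat -> R) (d : R) :
  (forall n, Rabs (a (S n) - a n) <= d / 2 ^ n) ->
  exists l, forall n, Rabs (a n - l) <= 2 * d / 2 ^ n.
Proof.
  intros H.
  (* Subtracting [2 * d / 2 ^ n] makes the sequence increasing, with steps at most
     [2 * d / 2 ^ n = 4 * d / 2 ^ S n]. *)
  destruct (nested_dyadic (fun n => a n - 2 * d / 2 ^ n) (4 * d)) as [l Hl].
  - intros n. specialize (H n). apply Rabs_le_between in H.
    assert (P : 0 < 2 ^ n) by (apply pow_lt; lra).
    replace (2 * d / 2 ^ n) with (2 * (d / 2 ^ n)) by (field; lra).
    replace (2 * d / 2 ^ S n) with (d / 2 ^ n) by (simpl; field; lra).
    replace (4 * d / 2 ^ S n) with (2 * (d / 2 ^ n)) by (simpl; field; lra).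
    lra.
  - exists l. intros n. specialize (Hl n).
    assert (P : 0 < 2 ^ n) by (apply pow_lt; lra).
    replace (4 * d / 2 ^ n) with (2 * (2 * d / 2 ^ n)) in Hl by (field; lra).
    apply Rabs_le. lra.
Qed.

(** Banach's theorem with ratio [1 / 2]; the last hypothesis says that [D] is closed. The limit of
    the iterates is built coordinate by coordinate. *)
Lemma contraction_fixed_point (D : C -> Prop) (T : C -> C) (w0 : C) :
  D w0 -> (forall w, D w -> D (T w)) ->
  (forall w w', D w -> D w' -> Cmod (T w - T w')%C <= / 2 * Cmod (w - w')%C) ->
  (forall l, (forall eps, 0 < eps -> exists w, D w /\ Cmod (w - l)%C < eps) -> D l) ->
  exists w, D w /\ T w = w.
Proof.
  intros H0 HT Hc Hcl.
  set (u := fun n => Nat.iter n T w0).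
  assert (Hu : forall n, D (u n)).
  { induction n as [|n IH]; simpl; auto. }
  set (d := Cmod (T w0 - w0)%C).
  assert (Hd : forall n, Cmod (u (S n) - u n)%C <= d / 2 ^ n).
  { induction n as [|n IH].
    - simpl. fold d. lra.
    - change (Cmod (T (u (S n)) - T (u n))%C <= d / 2 ^ S n).
      eapply Rle_trans; [apply Hc; auto|].
      replace (d / 2 ^ S n) with (/ 2 * (d / 2 ^ n)) by
        (simpl; field; apply pow_nonzero; lra).
      lra. }
  destruct (geometric_limit (fun n => Re (u n)) d) as [l1 H1].
  { intros n. eapply Rle_trans; [apply (re_le_Cmod (u (S n) - u n)%C)|apply Hd]. }
  destruct (geometric_limit (fun n => Im (u n)) d) as [l2 H2].
  { intros n. eapply Rle_trans; [apply (im_le_Cmod (u (S n) - u n)%C)|apply Hd]. }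
  set (l := (l1, l2) : C).
  assert (Hl : forall n, Cmod (u n - l)%C <= 4 * d / 2 ^ n).
  { intros n. specialize (H1 n). specialize (H2 n).
    eapply Rle_trans; [apply Cmod_le_abs|].
    change (Rabs (Re (u n) - l1) + Rabs (Im (u n) - l2) <= 4 * d / 2 ^ n).
    replace (4 * d / 2 ^ n) with (2 * d / 2 ^ n + 2 * d / 2 ^ n) by
      (field; apply pow_nonzero; lra).
    lra. }
  assert (Dl : D l).
  { apply Hcl. intros eps He. destruct (div_pow2_small (4 * d) eps He) as [n Hn].
    exists (u n). split; auto. specialize (Hl n). lra. }
  exists l. split; auto.
  (* Both [T l - T (u n)] and [u (S n) - l] are small for large [n]. *)
  assert (E : Cmod (T l - l)%C <= 0).
  { apply le_epsilon. intros eps He.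
    destruct (div_pow2_small (4 * d) (eps / 2) ltac:(lra)) as [n Hn].
    replace (T l - l)%C with ((T l - T (u n)) + (u (S n) - l))%C
      by (change (u (S n)) with (T (u n)); ring).
    eapply Rle_trans; [apply Cmod_triangle|].
    assert (A1 := Hc l (u n) Dl (Hu n)). rewrite (Cmod_sub_sym l) in A1.
    pose proof (Hl n). pose proof (Hl (S n)).
    assert (4 * d / 2 ^ S n = / 2 * (4 * d / 2 ^ n)) by
      (simpl; field; apply pow_nonzero; lra).
    assert (0 <= 4 * d / 2 ^ n) by (eapply Rle_trans; [apply Cmod_ge_0|apply Hl]).
    lra. }
  assert (Z : (T l - l)%C = 0).
  { apply Cmod_eq_0. apply Rle_antisym; auto. apply Cmod_ge_0. }
  replace (T l) with (T l - l + l)%C by ring. rewrite Z. ring.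
Qed.

Lemma Rabs_atan_le (t : R) : Rabs (atan t) <= Rabs t.
Proof.
  assert (H : Rabs (atan (1 * t) - atan (0 * t)) <= Rabs t).
  { apply (Rabs_increment_01 (fun s => atan (s * t))). intros s _.
    pose proof (pow2_ge_0 (s * t)).
    exists (t * / (1 + (s * t) ^ 2)). split.
    - auto_derive; auto. unfold Rsqr. field. simpl in *. lra.
    - rewrite Rabs_mult, Rabs_inv, (Rabs_pos_eq (1 + (s * t) ^ 2)) by lra.
      rewrite <- (Rmult_1_r (Rabs t)) at 2.
      apply Rmult_le_compat_l; [apply Rabs_pos|].
      rewrite <- Rinv_1. apply Rinv_le_contravar; lra. }
  rewrite Rmult_1_l, Rmult_0_l, atan_0, Rminus_0_r in H. exact H.
Qed.

(** * Estimates for [F] far to the left in the strip *)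

Definition differentiable_halfstrip (F : C -> C) (X0 alpha : R) : Prop :=
  forall w, Re w < X0 -> Rabs (Im w) < alpha -> exists l, Cderiv F w l.

Definition equiv_halfstrip (F : C -> C) (c alpha : R) : Prop :=
  forall e, 0 < e -> exists X, forall w, Re w < X -> Rabs (Im w) < alpha ->
    Cmod (F w + c * w)%C <= e * Cmod w.

(** The main term [- c * w] has real part [c * (- Re w)], which grows without bound, and bounded
    imaginary part; so [F w] enters the right half-plane with argument tending to 0. *)
Lemma equiv_halfstrip_Clog_bounds (F : C -> C) (c alpha eta : R) :
  0 < c -> 0 < eta -> alpha <= PI -> equiv_halfstrip F c alpha ->
  exists A, 0 < A /\ forall w, Re w <= - A -> Rabs (Im w) < alpha ->
    1 <= Re (F w) /\ - Re w * (c / 4) <= Re (F w) /\ Rabs (Im (Clog (F w))) <= eta.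
Proof.
  intros Hc He Ha H.
  set (e := Rmin (c / 4) (c * eta / 8)).
  assert (e1 : e <= c / 4) by apply Rmin_l.
  assert (e2 : e <= c * eta / 8) by apply Rmin_r.
  assert (e0 : 0 < e) by (apply Rmin_pos; nra).
  destruct (H e e0) as [X HX].
  (* With [x = - Re w], the bound [e <= c / 4] gives [Re (F w) >= c * x / 4], and [4 / c] raises
     this to 1. The bound [e <= c * eta / 8] leaves [|Im (F w)| <= 5 * c + c * eta * x / 8], and
     [48 / eta] lets [eta * c * x / 4] dominate it. *)
  exists (Rmax (1 - X) (Rmax 16 (Rmax (48 / eta) (4 / c)))).
  pose proof (Rmax_l (1 - X) (Rmax 16 (Rmax (48 / eta) (4 / c)))) as M1.
  pose proof (Rmax_r (1 - X) (Rmax 16 (Rmax (48 / eta) (4 / c)))) as M2.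
  pose proof (Rmax_l 16 (Rmax (48 / eta) (4 / c))) as M3.
  pose proof (Rmax_r 16 (Rmax (48 / eta) (4 / c))) as M4.
  pose proof (Rmax_l (48 / eta) (4 / c)) as M5.
  pose proof (Rmax_r (48 / eta) (4 / c)) as M6.
  set (A := Rmax (1 - X) _) in *.
  split; [lra|]. intros w Hw Hi.
  specialize (HX w ltac:(lra) Hi).
  pose proof PI_4.
  assert (Hm : Cmod w <= - Re w + 4).
  { eapply Rle_trans; [apply Cmod_le_abs|]. rewrite (Rabs_left1 (Re w)) by lra. lra. }
  pose proof (Rle_trans _ _ _ (re_le_Cmod _) HX) as HR.
  pose proof (Rle_trans _ _ _ (im_le_Cmod _) HX) as HI.
  replace (Re (F w + c * w)) with (Re (F w) + c * Re w) in HR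
    by (destruct (F w), w; simpl; ring).
  replace (Im (F w + c * w)) with (Im (F w) + c * Im w) in HI
    by (destruct (F w), w; simpl; ring).
  apply Rabs_le_between in HR, HI. apply Rabs_def2 in Hi.
  set (x := - Re w) in *.
  assert (x16 : 16 <= x) by (unfold x; lra).
  assert (xe : 48 <= eta * x).
  { assert (48 / eta <= x) by (unfold x; lra).
    apply Rmult_le_compat_l with (r := eta) in H1; [|lra].
    replace (eta * (48 / eta)) with 48 in H1 by (field; lra). exact H1. }
  assert (xc : 4 <= c * x).
  { assert (4 / c <= x) by (unfold x; lra).
    apply Rmult_le_compat_l with (r := c) in H1; [|lra].
    replace (c * (4 / c)) with 4 in H1 by (field; lra). exact H1. }
  assert (B : e * Cmod w <= e * (x + 4)) by (apply Rmult_le_compat_l; lra).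
  assert (B1 : e * (x + 4) <= c / 4 * (x + 4)) by (apply Rmult_le_compat_r; lra).
  assert (B2 : e * x <= c * eta / 8 * x) by (apply Rmult_le_compat_r; lra).
  assert (HRe : c * x / 4 <= Re (F w)).
  { replace (c * Re w) with (- (c * x)) in HR by (unfold x; ring). nra. }
  split; [lra|]. split; [lra|].
  assert (HIm : Rabs (Im (F w)) <= eta * Re (F w)).
  { apply Rle_trans with (eta * (c * x / 4)); [|apply Rmult_le_compat_l; lra].
    assert (C1 : Rabs (c * Im w) <= 4 * c).
    { rewrite Rabs_mult, (Rabs_pos_eq c) by lra.
      assert (Rabs (Im w) <= 4) by (apply Rabs_le; lra). nra. }
    apply Rabs_le_between in C1.
    assert (C2 : 5 * c <= eta * (c * x / 8)) by nra.
    apply Rabs_le. nra. }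
  change (Im (Clog (F w))) with (atan (Im (F w) / Re (F w))).
  eapply Rle_trans; [apply Rabs_atan_le|].
  assert (0 < Re (F w)) by lra.
  unfold Rdiv. rewrite Rabs_mult, Rabs_inv, (Rabs_pos_eq (Re (F w))) by lra.
  apply Rmult_le_reg_r with (Re (F w)); auto.
  rewrite Rmult_assoc, Rinv_l, Rmult_1_r by lra. exact HIm.
Qed.

(** On a disc of radius [r] the variation of [F] is at most [c * r + e * (2 * |w| + r)], so
    [|F'| <= c + e + 2 * e * |w| / r], whereas [|F w| >= c / 2 * |w|]. Taking [e <= c * r / 32]
    makes the linear term at most [c / 16 * |w|]. *)
Lemma equiv_halfstrip_deriv_bound (F : C -> C) (c X0 alpha b : R) :
  0 < c -> 0 < b < alpha ->
  differentiable_halfstrip F X0 alpha -> equiv_halfstrip F c alpha ->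
  exists A, 0 < A /\ forall w l, Re w <= - A -> Rabs (Im w) <= b ->
    Cderiv F w l -> Cmod l <= / 4 * Cmod (F w).
Proof.
  intros Hc Hb HD H.
  set (r := (alpha - b) / 2).
  assert (Hr : 0 < r) by (unfold r; lra).
  set (e := Rmin (c / 2) (c * r / 32)).
  assert (e1 : e <= c / 2) by apply Rmin_l.
  assert (e2 : e <= c * r / 32) by apply Rmin_r.
  assert (e0 : 0 < e) by (apply Rmin_pos; nra).
  destruct (H e e0) as [X HX].
  (* The margin [1 + r] keeps the whole disc to the left of [X] and [X0]; [|w| >= 32] absorbs the
     constant [c + e]. *)
  set (A := Rmax 32 (1 + r - Rmin X X0)).
  pose proof (Rmax_l 32 (1 + r - Rmin X X0)) as M1.
  pose proof (Rmax_r 32 (1 + r - Rmin X X0)) as M2.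
  pose proof (Rmin_l X X0) as M3. pose proof (Rmin_r X X0) as M4.
  fold A in M1, M2.
  exists A. split; [lra|]. intros w l Hw Hi Hl.
  assert (Hdisc : forall z, Cmod (z - w)%C <= r ->
    Re z < X /\ Re z < X0 /\ Rabs (Im z) < alpha).
  { intros z Hz.
    pose proof (Rle_trans _ _ _ (re_le_Cmod _) Hz) as HR.
    pose proof (Rle_trans _ _ _ (im_le_Cmod _) Hz) as HI.
    change (Re (z - w)) with (Re z - Re w) in HR.
    change (Im (z - w)) with (Im z - Im w) in HI.
    apply Rabs_le_between in HR. apply Rabs_le_between in HI. apply Rabs_le_between in Hi.
    repeat split; try lra. apply Rabs_def1; unfold r in *; lra. }
  assert (Hww : Cmod (w - w)%C <= r).
  { replace (w - w)%C with (RtoC 0) by ring. rewrite Cmod_0. lra. }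
  assert (HFw : Cmod (F w + c * w)%C <= e * Cmod w) by (apply HX; apply Hdisc, Hww).
  assert (Hest : Cmod l <= (c * r + e * (2 * Cmod w + r)) / r).
  { apply (cauchy_estimate F w); auto.
    - intros z Hz. apply HD; apply Hdisc, Hz.
    - intros z Hz.
      assert (HFz : Cmod (F z + c * z)%C <= e * Cmod z) by (apply HX; apply Hdisc, Hz).
      replace (F z - F w)%C with ((F z + c * z) - (F w + c * w) + (- c * (z - w)))%C by ring.
      eapply Rle_trans; [apply Cmod_triangle|].
      eapply Rle_trans; [apply Rplus_le_compat_r, Cmod_triangle|].
      rewrite Cmod_opp, Cmod_mult, Cmod_opp, Cmod_R, Rabs_pos_eq by lra.
      pose proof (Cmod_triangle_rev z w).
      assert (c * Cmod (z - w)%C <= c * r) by (apply Rmult_le_compat_l; lra).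
      assert (e * Cmod z <= e * (Cmod w + r)) by (apply Rmult_le_compat_l; lra).
      lra. }
  pose proof (re_le_Cmod w) as Hrw. rewrite Rabs_left1 in Hrw by lra.
  assert (Hlow : c / 2 * Cmod w <= Cmod (F w)).
  { pose proof (Cmod_triangle (F w + c * w) (- F w))%C as T2.
    replace (F w + c * w + - F w)%C with (c * w)%C in T2 by ring.
    rewrite Cmod_opp, Cmod_mult, Cmod_R, Rabs_pos_eq in T2 by lra.
    assert (e * Cmod w <= c / 2 * Cmod w) by (apply Rmult_le_compat_r; lra). lra. }
  apply Rle_trans with (1 := Hest).
  replace ((c * r + e * (2 * Cmod w + r)) / r) with (c + e + 2 * e * Cmod w / r)
    by (field; lra).
  assert (Q : 2 * e * Cmod w / r <= c / 16 * Cmod w).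
  { apply Rmult_le_reg_r with r; auto. unfold Rdiv at 1.
    rewrite Rmult_assoc, Rinv_l, Rmult_1_r by lra. nra. }
  nra.
Qed.

(** At a solution [w + Clog (F w) = v] this reads [F w ~ - c * v], the form needed for the
    equivalent of the inverse. It holds because [|Clog (F w)| <= ln |F w| + 1] is negligible against
    [|F w|]. *)
Lemma equiv_halfstrip_Clog (F : C -> C) (c alpha eps : R) :
  0 < c -> 0 < eps -> alpha <= PI -> equiv_halfstrip F c alpha ->
  exists A, 0 < A /\ forall w, Re w <= - A -> Rabs (Im w) < alpha ->
    Cmod (F w + c * (w + Clog (F w)))%C <= eps * Cmod (F w).
Proof.
  intros Hc He Ha H.
  destruct (equiv_halfstrip_Clog_bounds F c alpha 1 Hc Rlt_0_1 Ha H) as [A1 [HA1 B1]].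
  set (e := Rmin (c / 2) (eps * c / 4)).
  assert (e1 : e <= c / 2) by apply Rmin_l.
  assert (e2 : e <= eps * c / 4) by apply Rmin_r.
  assert (e0 : 0 < e) by (apply Rmin_pos; nra).
  destruct (H e e0) as [X HX].
  (* [ln m <= d * m - ln d] for every [d > 0], and [ln d] is absorbed as [m] is large. *)
  set (d := eps / (4 * c)).
  assert (Hd : 0 < d) by (apply Rdiv_lt_0_compat; lra).
  set (K := Rabs (ln d) + 1).
  pose proof (Rabs_pos (ln d)) as HK0.
  (* Through [Re (F w) >= - Re w * (c / 4)], the last entry gives [|F w| >= K / d], so that
     [d * |F w|] absorbs [K]. *)
  set (A := Rmax A1 (Rmax (1 - X) (4 * K / (c * d)))).
  pose proof (Rmax_l A1 (Rmax (1 - X) (4 * K / (c * d)))) as M1.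
  pose proof (Rmax_r A1 (Rmax (1 - X) (4 * K / (c * d)))) as M2.
  pose proof (Rmax_l (1 - X) (4 * K / (c * d))) as M3.
  pose proof (Rmax_r (1 - X) (4 * K / (c * d))) as M4.
  fold A in M1, M2.
  exists A. split; [lra|]. intros w Hw Hi.
  destruct (B1 w ltac:(lra) Hi) as (R1 & R2 & R3).
  specialize (HX w ltac:(lra) Hi).
  pose proof (re_le_Cmod (F w)) as Rm. rewrite Rabs_pos_eq in Rm by lra.
  assert (HFm : K / d <= Cmod (F w)).
  { assert (4 * K / (c * d) <= - Re w) by lra.
    apply Rmult_le_compat_r with (r := c / 4) in H0; [|lra].
    replace (4 * K / (c * d) * (c / 4)) with (K / d) in H0 by (field; lra). lra. }
  assert (HF0 : F w <> 0) by (apply Cmod_gt_0; lra).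
  assert (HL : Cmod (Clog (F w)) <= 2 * (d * Cmod (F w))).
  { eapply Rle_trans; [apply Cmod_le_abs|].
    rewrite Re_Clog by auto.
    assert (ln0 : 0 <= ln (Cmod (F w))).
    { rewrite <- ln_1. apply ln_le; lra. }
    rewrite Rabs_pos_eq by auto.
    assert (L : ln (d * Cmod (F w)) <= d * Cmod (F w) - 1).
    { assert (P : 0 < d * Cmod (F w)) by (apply Rmult_lt_0_compat; lra).
      pose proof (exp_ineq1_le (ln (d * Cmod (F w)))). rewrite exp_ln in *; lra. }
    rewrite ln_mult in L by lra.
    pose proof (Rle_abs (- ln d)). rewrite Rabs_Ropp in *.
    apply Rmult_le_compat_l with (r := d) in HFm; [|lra].
    replace (d * (K / d)) with K in HFm by (field; lra). unfold K in *. lra. }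
  assert (Hlow : c / 2 * Cmod w <= Cmod (F w)).
  { pose proof (Cmod_triangle (F w + c * w) (- F w))%C as T2.
    replace (F w + c * w + - F w)%C with (c * w)%C in T2 by ring.
    rewrite Cmod_opp, Cmod_mult, Cmod_R, Rabs_pos_eq in T2 by lra.
    pose proof (Cmod_ge_0 w).
    assert (e * Cmod w <= c / 2 * Cmod w) by (apply Rmult_le_compat_r; lra). lra. }
  replace (F w + c * (w + Clog (F w)))%C with ((F w + c * w) + c * Clog (F w))%C by ring.
  eapply Rle_trans; [apply Cmod_triangle|].
  rewrite Cmod_mult, Cmod_R, Rabs_pos_eq by lra.
  assert (Z1 : e * Cmod w <= eps / 2 * Cmod (F w)).
  { apply Rle_trans with (eps / 2 * (c / 2 * Cmod w)).
    - replace (eps / 2 * (c / 2 * Cmod w)) with (eps * c / 4 * Cmod w) by field.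
      apply Rmult_le_compat_r; auto. apply Cmod_ge_0.
    - apply Rmult_le_compat_l; lra. }
  assert (Z2 : c * Cmod (Clog (F w)) <= eps / 2 * Cmod (F w)).
  { apply Rmult_le_compat_l with (r := c) in HL; [|lra].
    replace (c * (2 * (d * Cmod (F w)))) with (eps / 2 * Cmod (F w)) in HL
      by (unfold d; field; lra). exact HL. }
  lra.
Qed.

Lemma Im_segment_le (a b : C) (t k : R) : 0 <= t <= 1 ->
  Rabs (Im a) <= k -> Rabs (Im b) <= k -> Rabs (Im (a + t * (b - a))%C) <= k.
Proof.
  intros Ht Ha Hb. replace (Im (a + t * (b - a))) with (Im a + t * (Im b - Im a))
    by (destruct a, b; simpl; ring).
  apply Rabs_le_between in Ha, Hb. apply Rabs_le. nra.
Qed.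

Lemma Re_segment_le (a b : C) (t k : R) : 0 <= t <= 1 ->
  Re a <= k -> Re b <= k -> Re (a + t * (b - a))%C <= k.
Proof.
  intros Ht Ha Hb. replace (Re (a + t * (b - a))) with (Re a + t * (Re b - Re a))
    by (destruct a, b; simpl; ring).
  nra.
Qed.

(** Uniqueness is stated after exponentiation because that is the form [psi z = y] takes. The
    Lipschitz bound is the only regularity of [W] needed to differentiate the inverse. *)
Lemma halfstrip_inverse (F : C -> C) (c X0 alpha beta : R) :
  0 < c -> 0 < beta < alpha -> alpha <= PI ->
  differentiable_halfstrip F X0 alpha -> equiv_halfstrip F c alpha ->
  exists (A : R) (W : C -> C), - A < X0 /\
    (forall v, Re v < - A -> Rabs (Im v) < beta ->
      Re (W v) <= Re v /\ Rabs (Im (W v)) < alpha /\ 0 < Re (F (W v)) /\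
      (W v + Clog (F (W v)))%C = v) /\
    (forall v w, Re v < - A -> Rabs (Im v) < beta ->
      Re w < - A -> Rabs (Im w) < alpha ->
      (Cexp w * F w)%C = Cexp v -> w = W v) /\
    (forall v v', Re v < - A -> Rabs (Im v) < beta ->
      Re v' < - A -> Rabs (Im v') < beta ->
      Cmod (W v - W v')%C <= 2 * Cmod (v - v')%C).
Proof.
  intros Hc Hb Ha HD H.
  set (eta := (alpha - beta) / 2).
  set (b := beta + eta).
  assert (Heta : 0 < eta) by (unfold eta; lra).
  assert (Hbb : 0 < b < alpha) by (unfold b, eta; lra).
  destruct (equiv_halfstrip_Clog_bounds F c alpha eta Hc Heta Ha H) as [A1 [HA1 B1]].
  destruct (equiv_halfstrip_deriv_bound F c X0 alpha b Hc Hbb HD H) as [A2 [HA2 B2]].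
  set (A := Rmax (1 - X0) (Rmax A1 A2)).
  pose proof (Rmax_l (1 - X0) (Rmax A1 A2)) as M1.
  pose proof (Rmax_r (1 - X0) (Rmax A1 A2)) as M2.
  pose proof (Rmax_l A1 A2) as M3. pose proof (Rmax_r A1 A2) as M4.
  fold A in M1, M2.
  (* The inequalities are not strict, so that [D] is closed. *)
  set (D := fun w : C => Re w <= - A /\ Rabs (Im w) <= b).
  set (L := fun w => Clog (F w)).
  assert (HReL : forall w, Re w <= - A -> Rabs (Im w) < alpha -> 0 <= Re (L w)).
  { intros w H1 H2. destruct (B1 w ltac:(lra) H2) as (R1 & _ & _).
    pose proof (re_le_Cmod (F w)) as Rm. rewrite Rabs_pos_eq in Rm by lra.
    unfold L. rewrite Re_Clog by (apply Cmod_gt_0; lra).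
    rewrite <- ln_1. apply ln_le; lra. }
  assert (HLip : forall w w', D w -> D w' ->
    Cmod (L w - L w')%C <= / 2 * Cmod (w - w')%C).
  { intros w w' [D1 D2] [D3 D4].
    replace (/ 2) with (2 * / 4) by field.
    apply Clog_lipschitz; [lra|]. intros t Ht.
    pose proof (Re_segment_le w' w t _ Ht D3 D1) as S1.
    pose proof (Im_segment_le w' w t _ Ht D4 D2) as S2.
    set (z := (w' + t * (w - w'))%C) in *.
    destruct (HD z ltac:(lra) ltac:(lra)) as [l Hl].
    destruct (B1 z ltac:(lra) ltac:(lra)) as (R1 & _ & _).
    exists l. repeat split; auto; [lra|]. apply B2; auto; lra. }
  assert (HT : forall v, Re v < - A -> Rabs (Im v) < beta ->
    forall w, Re w <= - A -> Rabs (Im w) < alpha ->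
    Re (v - L w)%C <= Re v /\ Rabs (Im (v - L w)%C) <= b).
  { intros v V1 V2 w W1 W2. split.
    - change (Re v - Re (L w) <= Re v). pose proof (HReL w W1 W2). lra.
    - change (Rabs (Im v - Im (L w)) <= b).
      destruct (B1 w ltac:(lra) W2) as (_ & _ & R3). fold (L w) in R3.
      unfold Rminus. eapply Rle_trans; [apply Rabs_triang|].
      rewrite Rabs_Ropp. unfold b. lra. }
  (* The conditions on [v] stand under the existential so that choice produces a total [W];
     elsewhere the witness is the arbitrary value 0. *)
  assert (HW : forall v, exists w, Re v < - A -> Rabs (Im v) < beta ->
    D w /\ (v - L w)%C = w).
  { intros v. destruct (classic (Re v < - A /\ Rabs (Im v) < beta)) as [[V1 V2]|N].
    2:{ exists 0. intros V1 V2. exfalso. apply N. auto. }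
    destruct (contraction_fixed_point D (fun w => (v - L w)%C) v) as [w Hw].
    - split; [lra|]. unfold b. lra.
    - intros w [D1 D2]. destruct (HT v V1 V2 w D1 ltac:(lra)). split; auto. lra.
    - intros w w' D1 D2. rewrite (Cmod_sub_sym w w').
      replace (v - L w - (v - L w'))%C with (L w' - L w)%C by ring. auto.
    - intros l Hl. split.
      + apply le_epsilon. intros eps Heps.
        destruct (Hl eps Heps) as (w & [D1 D2] & Hw).
        pose proof (re_le_Cmod (w - l)%C) as Q.
        change (Re (w - l)) with (Re w - Re l) in Q.
        pose proof (Rle_trans _ _ _ Q (Rlt_le _ _ Hw)) as Q'.
        apply Rabs_le_between in Q'. lra.
      + apply le_epsilon. intros eps Heps.
        destruct (Hl eps Heps) as (w & [D1 D2] & Hw).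
        pose proof (im_le_Cmod (w - l)%C) as Q.
        change (Im (w - l)) with (Im w - Im l) in Q.
        pose proof (Rle_trans _ _ _ Q (Rlt_le _ _ Hw)) as Q'.
        apply Rabs_le_between in Q'. apply Rabs_le_between in D2. apply Rabs_le. lra.
    - exists w. auto. }
  set (W := fun v => proj1_sig (constructive_indefinite_description _ (HW v))).
  assert (WP := fun v => proj2_sig (constructive_indefinite_description _ (HW v))).
  fold W in WP.
  assert (WE : forall v, proj1_sig (constructive_indefinite_description _ (HW v)) = W v)
    by reflexivity.
  setoid_rewrite WE in WP. clear WE.
  (* Absorbing the half-Lipschitz term gives the constant 2; with [v = v'] the same inequality is
     uniqueness. *)
  assert (Hstable : forall v v' w w', D w -> D w' -> (v - L w)%C = w -> (v' - L w')%C = w' ->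
    Cmod (w - w')%C <= 2 * Cmod (v - v')%C).
  { intros v v' w w' D1 D2 E1 E2.
    assert (E : (w - w')%C = ((v - v') - (L w - L w'))%C) by (rewrite <- E1, <- E2 at 1; ring).
    pose proof (HLip w w' D1 D2).
    pose proof (Cmod_triangle (v - v') (- (L w - L w')))%C as T.
    rewrite Cmod_opp in T. change (v - v' + - (L w - L w'))%C with (v - v' - (L w - L w'))%C in T.
    rewrite <- E in T. lra. }
  exists A, W. split; [lra|]. split; [|split].
  - intros v V1 V2. destruct (WP v V1 V2) as [[D1 D2] E].
    assert (I : Rabs (Im (W v)) < alpha) by lra.
    repeat split; auto.
    + rewrite <- E at 1. apply HT; auto.
    + destruct (B1 (W v) ltac:(lra) I) as (R1 & _ & _). lra.
    + fold (L (W v)). rewrite <- E at 1. ring.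
  - intros v w V1 V2 W1 W2 E.
    destruct (B1 w ltac:(lra) W2) as (R1 & _ & R3).
    (* The imaginary parts of the two sides differ by less than
       [alpha + eta + beta < 2 * alpha <= 2 * pi], so the exponential can be removed. *)
    assert (EL : (w + L w)%C = v).
    { apply Cexp_inj.
      - rewrite Cexp_plus. unfold L. rewrite Cexp_Clog by lra. exact E.
      - change (Im (w + L w)) with (Im w + Im (L w)). fold (L w) in R3.
        apply Rabs_def2 in W2, V2. apply Rabs_le_between in R3.
        apply Rabs_def1; unfold eta in *; lra. }
    assert (Ew : (v - L w)%C = w) by (rewrite <- EL; ring).
    assert (Dw : D w).
    { split; [lra|]. rewrite <- Ew. apply HT; auto. lra. }
    destruct (WP v V1 V2) as [Dv Ev].
    pose proof (Hstable v v w (W v) Dw Dv Ew Ev) as S.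
    replace (v - v)%C with (RtoC 0) in S by ring. rewrite Cmod_0, Rmult_0_r in S.
    assert (Z : (w - W v)%C = 0).
    { apply Cmod_eq_0. apply Rle_antisym; auto. apply Cmod_ge_0. }
    replace w with (w - W v + W v)%C by ring. rewrite Z. ring.
  - intros v v' V1 V2 V1' V2'.
    destruct (WP v V1 V2). destruct (WP v' V1' V2'). apply Hstable; auto.
Qed.

(** * Back to sectors *)

Lemma sector_Cexp (rho alpha : R) (z : C) : 0 < rho ->
  sector rho alpha z <-> exists w, z = Cexp w /\ Re w < ln rho /\ Rabs (Im w) < alpha.
Proof.
  intros Hrho. split.
  - intros (r & t & Hr & Ht & ->). exists (ln r, t). split; [|split]; auto.
    + unfold Cexp; simpl. now rewrite exp_ln by lra.
    + simpl. apply ln_increasing; lra.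
  - intros ([x t] & -> & Hx & Ht). exists (exp x), t. simpl in *.
    split; [split|split]; auto using exp_pos.
    rewrite <- (exp_ln rho) by auto. apply exp_increasing; auto.
Qed.

(** The lift is [v0 + Clog (1 + u)] with [u = h / exp v0]. For [|u| <= 1 / 2] the segment from 1 to
    [1 + u] stays where the modulus is at least [1 / 2], so the logarithm is 4-Lipschitz there,
    whence [K = 4 / m]. No regularity of [Cln] is needed. *)
Lemma Cexp_local_section (v0 : C) : exists delta K, 0 < delta /\ 0 < K /\
  forall h, Cmod h < delta -> exists v,
    Cexp v = (Cexp v0 + h)%C /\ Cmod (v - v0)%C <= K * Cmod h.
Proof.
  pose proof (Cexp_neq_0 v0) as Hn. assert (Hm := proj1 (Cmod_gt_0 _) Hn).
  set (m := Cmod (Cexp v0)) in *.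
  exists (m / 2), (4 / m). split; [lra|]. split; [apply Rdiv_lt_0_compat; lra|].
  intros h Hh. set (u := (h / Cexp v0)%C).
  assert (Hu : Cmod u = Cmod h / m) by now apply Cmod_div.
  assert (Hu2 : Cmod u <= / 2).
  { rewrite Hu. apply Rmult_le_reg_r with m; auto. unfold Rdiv.
    rewrite Rmult_assoc, Rinv_l by lra. lra. }
  assert (Hre : forall t : R, 0 <= t <= 1 -> / 2 <= Re (1 + t * u)%C).
  { intros t Ht. replace (Re (1 + t * u)) with (1 + t * Re u) by (destruct u; simpl; ring).
    pose proof (Rle_trans _ _ _ (re_le_Cmod u) Hu2) as Q. apply Rabs_le_between in Q. nra. }
  assert (Hre1 : / 2 <= Re (1 + u)%C).
  { replace (1 + u)%C with (1 + 1 * u)%C by ring. apply Hre. lra. }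
  exists (v0 + Clog (1 + u))%C. split.
  - rewrite Cexp_plus, Cexp_Clog by lra. unfold u. field. exact Hn.
  - replace (v0 + Clog (1 + u) - v0)%C with (Clog (1 + u) - Clog 1)%C.
    2:{ assert (E : Clog 1 = 0).
        { unfold Clog. simpl. replace (1 * (1 * 1) + 0 * (0 * 1)) with 1 by ring.
          unfold Rdiv. rewrite Rmult_0_l, atan_0, ln_1, Rmult_0_r. reflexivity. }
        rewrite E. ring. }
    eapply Rle_trans; [apply (Clog_lipschitz (fun z => z) 1 (1 + u)%C 2); [lra|]|].
    + intros t Ht. exists 1. split; [apply Cderiv_id|].
      replace (1 + t * (1 + u - 1))%C with (1 + t * u)%C by ring.
      specialize (Hre t Ht). rewrite Cmod_1.
      pose proof (re_le_Cmod (1 + t * u)%C) as Q. rewrite Rabs_pos_eq in Q by lra.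
      split; lra.
    + replace (1 + u - 1)%C with u by ring. rewrite Hu. right. field. lra.
Qed.

(** The Lipschitz bound on [g] turns the expansion of [f] into [h - l * (g (y0 + h) - g y0) = o(h)].
    This also forces [l <> 0], since otherwise [h = o(h)]; dividing by [l] concludes. *)
Lemma Cderiv_inverse (f g : C -> C) (y0 l : C) :
  Cderiv f (g y0) l -> f (g y0) = y0 ->
  (exists delta K, 0 < delta /\ 0 < K /\ forall h, Cmod h < delta ->
    f (g (y0 + h)%C) = (y0 + h)%C /\ Cmod (g (y0 + h) - g y0)%C <= K * Cmod h) ->
  Cderiv g y0 (/ l).
Proof.
  intros Hl E0 (d & K & Hd & HK & Hinv).
  assert (Hexp : forall e, 0 < e -> exists d', 0 < d' /\ forall h, Cmod h < d' ->
    Cmod (h - l * (g (y0 + h) - g y0))%C <= e * Cmod h).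
  { intros e He. destruct (Hl (e / K)) as [d1 [Hd1 H1]].
    { apply Rdiv_lt_0_compat; lra. }
    exists (Rmin d (d1 / K)).
    assert (0 < d1 / K) by (apply Rdiv_lt_0_compat; lra).
    split; [apply Rmin_pos; auto|]. intros h Hh.
    apply Rmin_Rgt_l in Hh as [h1 h2].
    destruct (Hinv h h1) as [I1 I2].
    assert (Hk : Cmod (g (y0 + h) - g y0)%C < d1).
    { apply Rle_lt_trans with (1 := I2).
      apply Rgt_lt, Rmult_lt_compat_l with (r := K) in h2; [|lra].
      replace (K * (d1 / K)) with d1 in h2 by (field; lra). exact h2. }
    specialize (H1 _ Hk).
    replace (g y0 + (g (y0 + h) - g y0))%C with (g (y0 + h))%C in H1 by ring.
    rewrite I1, E0 in H1. replace (y0 + h - y0)%C with h in H1 by ring.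
    apply Rle_trans with (1 := H1).
    apply Rle_trans with (e / K * (K * Cmod h)).
    - apply Rmult_le_compat_l; auto. left; apply Rdiv_lt_0_compat; lra.
    - right. field. lra. }
  assert (Hn : l <> 0).
  { intros ->. destruct (Hexp (/ 2)) as [d' [Hd' H']]; [lra|].
    specialize (H' (RtoC (d' / 2))).
    rewrite Cmod_R, Rabs_pos_eq in H' by lra. specialize (H' ltac:(lra)).
    replace (RtoC (d' / 2) - 0 * (g (y0 + RtoC (d' / 2)) - g y0))%C
      with (RtoC (d' / 2)) in H' by ring.
    rewrite Cmod_R, Rabs_pos_eq in H' by lra. lra. }
  assert (Hm := proj1 (Cmod_gt_0 _) Hn).
  intros eps Heps. destruct (Hexp (eps * Cmod l)) as [d' [Hd' H']]; [nra|].
  exists d'. split; auto. intros h Hh. specialize (H' h Hh).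
  replace (g (y0 + h) - g y0 - / l * h)%C
    with (- (h - l * (g (y0 + h) - g y0)) / l)%C by (field; auto).
  rewrite Cmod_div, Cmod_opp by auto.
  apply Rmult_le_reg_r with (Cmod l); auto. unfold Rdiv.
  rewrite Rmult_assoc, Rinv_l by lra. lra.
Qed.

(** * Transfer between [psi] and the half-strip *)

Definition log_quotient (psi : C -> C) (w : C) : C := (psi (Cexp w) * Cexp (- w))%C.

Lemma log_quotient_eq (psi : C -> C) (w : C) :
  (Cexp w * log_quotient psi w)%C = psi (Cexp w).
Proof.
  unfold log_quotient. rewrite Cexp_opp. field. apply Cexp_neq_0.
Qed.

(** Writing the division by [exp w] as the factor [Cexp (- w)] reduces this to the product and chain
    rules. *)
Lemma log_quotient_differentiable (psi : C -> C) (s alpha : R) : 0 < s ->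
  analytic_on (sector s alpha) psi ->
  differentiable_halfstrip (log_quotient psi) (ln s) alpha.
Proof.
  intros Hs H w W1 W2.
  destruct (H (Cexp w)) as [l Hl].
  { apply sector_Cexp; auto. exists w; auto. }
  apply is_derive_Cderiv in Hl. eexists. unfold log_quotient.
  apply (Cderiv_mult (fun w => psi (Cexp w))).
  - apply (Cderiv_comp psi Cexp); [apply Cderiv_Cexp | exact Hl].
  - apply (Cderiv_comp Cexp (fun u => - u)%C); [|apply Cderiv_Cexp].
    apply Cderiv_ext with (fun u => (- (1)) * u + 0)%C; [intros; ring|].
    apply Cderiv_affine, Cderiv_id.
Qed.

Lemma log_quotient_equiv (psi : C -> C) (s alpha c : R) : 0 < s -> 0 < c -> alpha <= PI ->
  equiv_at0 (sector s alpha) psi (fun z => (- (RtoC c * z * Cln z)))%C ->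
  equiv_halfstrip (log_quotient psi) c alpha.
Proof.
  intros Hs Hc Ha H e He.
  (* The hypothesis measures the error against [|c * z * ln z|], the conclusion against [|w|]; hence
     the division by [c]. *)
  destruct (H (e / c)) as [d [Hd H']]; [apply Rdiv_lt_0_compat; lra|].
  exists (Rmin (ln d) (ln s)). intros w W1 W2.
  apply Rmin_Rgt_l in W1 as [W1 W1'].
  specialize (H' (Cexp w)).
  rewrite Cln_Cexp in H' by lra.
  assert (Hp := proj1 (Cmod_gt_0 _) (Cexp_neq_0 w)).
  apply Rmult_le_reg_l with (Cmod (Cexp w)); auto.
  rewrite <- Cmod_mult.
  replace (Cexp w * (log_quotient psi w + c * w))%C
    with (psi (Cexp w) - - (c * Cexp w * w))%C by (rewrite <- log_quotient_eq; ring).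
  eapply Rle_trans; [apply H'|].
  - apply sector_Cexp; auto. exists w; auto.
  - rewrite Cmod_Cexp, <- (exp_ln d) by auto. apply exp_increasing; auto.
  - rewrite Cmod_opp, !Cmod_mult, Cmod_R, (Rabs_pos_eq c) by lra. right. field. lra.
Qed.

Theorem theorem6p2p1 (psi : C -> C) (s alpha : R) :
  0 < s -> PI / 2 < alpha <= PI ->
  analytic_on (sector s alpha) psi ->
  forall c : R, 0 < c ->
  equiv_at0 (sector s alpha) psi (fun z => (- (RtoC c * z * Cln z)))%C ->
  forall beta : R, 0 < beta < alpha ->
  exists (rho rho' : R) (Ups : C -> C),
    0 < rho < s /\ 0 < rho' /\
    analytic_on (sector rho' beta) Ups /\
    (forall y, sector rho' beta y -> sector rho alpha (Ups y)) /\
    (forall y z, sector rho' beta y -> sector rho alpha z ->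
       (psi z = y <-> z = Ups y)) /\
    equiv_at0 (sector rho' beta) Ups (fun y => (- (y / (RtoC c * Cln y))))%C.
Proof.
  intros Hs [_ Ha] Hpsi c Hc Hequiv beta Hb.
  pose proof (log_quotient_differentiable psi s alpha Hs Hpsi) as HD.
  pose proof (log_quotient_equiv psi s alpha c Hs Hc Ha Hequiv) as HE.
  destruct (halfstrip_inverse _ c (ln s) alpha beta Hc Hb Ha HD HE)
    as (A & W & HA & HW & HU & HL).
  set (F := log_quotient psi) in *.
  set (rho := exp (- A)).
  assert (Hrho : 0 < rho) by apply exp_pos.
  assert (Eln : ln rho = - A) by apply ln_exp.
  set (Ups := fun y => Cexp (W (Cln y))).
  assert (HUps : forall v, Rabs (Im v) < beta -> Ups (Cexp v) = Cexp (W v)).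
  { intros v Hv. unfold Ups. rewrite Cln_Cexp by lra. reflexivity. }
  assert (HWF : forall v, Re v < - A -> Rabs (Im v) < beta -> psi (Cexp (W v)) = Cexp v).
  { intros v V1 V2. destruct (HW v V1 V2) as (_ & _ & P & E).
    rewrite <- E at 2. rewrite Cexp_plus, Cexp_Clog by auto.
    symmetry. apply log_quotient_eq. }
  exists rho, rho, Ups.
  assert (Hrs : rho < s).
  { rewrite <- (exp_ln s) by auto. apply exp_increasing; auto. }
  split; [auto|]. split; [auto|]. split; [|split; [|split]].
  - intros y Hy. apply sector_Cexp in Hy as (v0 & -> & V1 & V2); auto. rewrite Eln in V1.
    destruct (HW v0 V1 V2) as (B1 & B2 & _).
    destruct (Hpsi (Cexp (W v0))) as [l Hl].
    { apply sector_Cexp; auto. exists (W v0). repeat split; auto. lra. }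
    apply is_derive_Cderiv in Hl.
    exists (/ l)%C. apply is_derive_Cderiv.
    apply (Cderiv_inverse psi).
    + now rewrite HUps.
    + rewrite HUps by auto. auto.
    + destruct (Cexp_local_section v0) as (d1 & K1 & Hd1 & HK1 & H1).
      destruct (Cderiv_bounded _ _ _ (Cderiv_Cexp (W v0))) as (d2 & Hd2 & H2).
      set (K2 := Cmod (Cexp (W v0)) + 1) in *.
      assert (HK2 : 0 < K2) by (unfold K2; pose proof (Cmod_ge_0 (Cexp (W v0))); lra).
      (* The first two margins keep a lift [v] of [y] in the open half-strip; [d2 / 2] and the
         constant 2 of [W] keep [W v - W v0] within reach of the bound for [Cexp]. *)
      set (m := Rmin (Rmin (- A - Re v0) (beta - Rabs (Im v0))) (d2 / 2)).
      assert (Hm : 0 < m) by (repeat apply Rmin_pos; lra).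
      assert (Hm' : 0 < m / K1) by (apply Rdiv_lt_0_compat; lra).
      (* The product of the local Lipschitz constants of the lift, of [W] and of [Cexp]. *)
      exists (Rmin d1 (m / K1)), (K2 * (2 * K1)).
      split; [apply Rmin_pos; auto|]. split; [nra|].
      intros h Hh. apply Rmin_Rgt_l in Hh as [h1 h2].
      destruct (H1 h h1) as (v & Ev & Dv). rewrite <- Ev.
      assert (Dm : Cmod (v - v0)%C < m).
      { apply Rle_lt_trans with (1 := Dv).
        apply Rgt_lt, Rmult_lt_compat_l with (r := K1) in h2; [|lra].
        replace (K1 * (m / K1)) with m in h2 by (field; lra). exact h2. }
      pose proof (Rmin_l (Rmin (- A - Re v0) (beta - Rabs (Im v0))) (d2 / 2)) as m1.
      pose proof (Rmin_r (Rmin (- A - Re v0) (beta - Rabs (Im v0))) (d2 / 2)) as m2.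
      pose proof (Rmin_l (- A - Re v0) (beta - Rabs (Im v0))) as m3.
      pose proof (Rmin_r (- A - Re v0) (beta - Rabs (Im v0))) as m4.
      fold m in m1, m2.
      assert (V1' : Re v < - A).
      { pose proof (re_le_Cmod (v - v0)%C) as Q.
        change (Re (v - v0)) with (Re v - Re v0) in Q.
        pose proof (Rle_abs (Re v - Re v0)). lra. }
      assert (V2' : Rabs (Im v) < beta).
      { pose proof (im_le_Cmod (v - v0)%C) as Q.
        change (Im (v - v0)) with (Im v - Im v0) in Q.
        pose proof (Rabs_triang_inv (Im v) (Im v0)). lra. }
      rewrite !HUps by auto. split; [auto|].
      pose proof (HL v v0 V1' V2' V1 V2) as D.
      specialize (H2 (W v - W v0)%C ltac:(lra)).
      replace (W v0 + (W v - W v0))%C with (W v) in H2 by ring.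
      apply Rle_trans with (1 := H2). rewrite Rmult_assoc.
      apply Rmult_le_compat_l; lra.
  - intros y Hy. apply sector_Cexp in Hy as (v & -> & V1 & V2); auto. rewrite Eln in V1.
    rewrite HUps by auto. destruct (HW v V1 V2) as (B1 & B2 & _).
    apply sector_Cexp; auto. exists (W v). repeat split; auto. lra.
  - intros y z Hy Hz.
    apply sector_Cexp in Hy as (v & -> & V1 & V2); auto. rewrite Eln in V1.
    apply sector_Cexp in Hz as (w & -> & W1 & W2); auto. rewrite Eln in W1.
    rewrite HUps by auto. split.
    + intros E. f_equal. apply HU; auto. unfold F. now rewrite log_quotient_eq.
    + intros ->. auto.
  - intros eps Heps.
    destruct (equiv_halfstrip_Clog F c alpha eps Hc Heps Ha HE) as (B & HB & HF).
    (* The first bound puts [v], hence also [W v], to the left of [- B]; the second makes [Re v]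
       negative, so that [Cln y = v] is non-zero. *)
    exists (Rmin (exp (- B)) 1).
    split; [apply Rmin_pos; [apply exp_pos | lra]|].
    intros y Hy Hd. apply sector_Cexp in Hy as (v & -> & V1 & V2); auto. rewrite Eln in V1.
    apply Rmin_Rgt_l in Hd as [Hd Hd1]. rewrite Cmod_Cexp in Hd, Hd1.
    apply Rgt_lt, exp_lt_inv in Hd.
    rewrite <- exp_0 in Hd1. apply Rgt_lt, exp_lt_inv in Hd1.
    rewrite HUps, Cln_Cexp by lra.
    destruct (HW v V1 V2) as (B1 & B2 & P & E).
    specialize (HF (W v) ltac:(lra) B2). rewrite E in HF.
    pose proof (HWF v V1 V2) as Q. rewrite <- log_quotient_eq in Q. fold F in Q.
    (* Once [y] is written as [z * F (W v)], the error and the comparison term share the factor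
       [z / (c * v)], and only [F (W v) ~ - c * v] remains. *)
    rewrite <- Q.
    assert (Hv : v <> 0) by (intros ->; simpl in Hd1; lra).
    assert (Hc0 : RtoC c <> 0) by (intros K; apply RtoC_inj in K; lra).
    set (z := Cexp (W v)) in *.
    replace (z - - (z * F (W v) / (c * v)))%C with (z / (c * v) * (F (W v) + c * v))%C
      by (field; auto).
    rewrite Cmod_opp.
    replace (z * F (W v) / (c * v))%C with (z / (c * v) * F (W v))%C by (field; auto).
    rewrite !Cmod_mult.
    replace (eps * (Cmod (z / (c * v))%C * Cmod (F (W v))))
      with (Cmod (z / (c * v))%C * (eps * Cmod (F (W v)))) by ring.
    apply Rmult_le_compat_l; [apply Cmod_ge_0 | exact HF].
Qed.
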